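(* Let $n=2$. Let $H=H(x,p,u):\mathbb{R}^2\times\mathbb{R}^2\times\mathbb{R}\to\mathbb{R}$ be of class $C^1$ and such that $H(x,\cdot,u)$ is strictly convex for all $(x,u)\in\mathbb{R}^2\times\mathbb{R}$. Let $\Omega\subset\mathbb{R}^2$ be a connected open set and let $u:\Omega\to\mathbb{R}$ be a locally semiconcave (viscosity) solution of $H(x,Du(x),u(x))=0$ in $\Omega$. Then for any $x_0\in\Sigma(u)$ there exist $t_0>0$ and a Lipschitz curve $\gamma:[0,t_0]\to\mathbb{R}^2$ with $\gamma(0)=x_0$ such that: (1) the right derivative $\dot{\gamma}^{+}(t)$ exists and $\dot{\gamma}^{+}(t)=v^{\#}(\gamma(t))$ for all $t\in[0,t_0)$; (2) $\lim_{s\to t^+}v^{\#}(\gamma(s))=v^{\#}(\gamma(t))$ for all $t\in[0,t_0)$; (3) $\gamma(t)\in\Sigma(u)$ for all $t\in[0,t_0]$.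
   Context: A function $u:V\to\mathbb{R}$ on a convex set $V$ is semiconcave (with linear modulus) if there is a constant $C>0$ with $\lambda u(x)+(1-\lambda)u(y)-u(\lambda x+(1-\lambda)y)\leqslant\frac C2\lambda(1-\lambda)|x-y|^2$ for all $x,y\in V$, $\lambda\in[0,1]$. A function $u:\Omega\to\mathbb{R}$ is locally semiconcave if each $x\in\Omega$ has an open ball $B(x,r)\subset\Omega$ on which $u$ is semiconcave. A viscosity solution of $H(x,Du(x),u(x))=0$ in $\Omega$ means here a locally semiconcave function $u$ that satisfies the equation at almost every point of $\Omega$. The superdifferential is $D^+u(x)=\{p\in\mathbb{R}^n:\limsup_{y\to x}\frac{u(y)-u(x)-\langle p,y-x\rangle}{|y-x|}\leqslant 0\}$; for locally semiconcave $u$ it is a nonempty compact convex set. The singular set $\Sigma(u)$ is the set of $x\in\Omega$ such that $D^+u(x)$ is not a singleton. For $x\in\Omega$, $p^{\#}(x)$ denotes the unique element of $D^{+}u(x)$ such that $H(x,p^{\#}(x),u(x))\leqslant H(x,p,u(x))$ for all $p\in D^{+}u(x)$ (it exists and is unique by strict convexity of $H$ in $p$), and $v^{\#}(x)=H_p(x,p^{\#}(x),u(x))$, where $H_p$ is the gradient of $H$ in the variable $p$. The right derivative is $\dot\gamma^+(t)=\lim_{s\to t^+}\frac{\gamma(s)-\gamma(t)}{s-t}$. *)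

(* Defs.v *)
From HB Require Import structures.
From mathcomp Require Import all_boot all_order all_algebra.
From mathcomp Require Import all_classical all_reals all_analysis.

Set Implicit Arguments.
Unset Strict Implicit.
Unset Printing Implicit Defensive.

Import Order.TTheory GRing.Theory Num.Theory.
Import numFieldNormedType.Exports.

Local Open Scope classical_set_scope.
Local Open Scope ring_scope.

(* The library norm `|x| on row vectors is the sup norm; dot and enorm are the
   Euclidean inner product and norm. The two norms induce the same topology,
   so the library's filters, limits, open sets and differentials on 'rV[R]_n
   are the usual ones. *)
Definition dot {R : realType} {n : nat} (x y : 'rV[R]_n) : R :=
  \sum_(i < n) x ord0 i * y ord0 i.

Definition enorm {R : realType} {n : nat} (x : 'rV[R]_n) : R :=
  Num.sqrt (dot x x).

Definition eball {R : realType} {n : nat} (x : 'rV[R]_n) (r : R) :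
    set 'rV[R]_n :=
  [set y | enorm (y - x) < r].

Definition grad {R : realType} {n : nat} (f : 'rV[R]_n -> R) (x : 'rV[R]_n) :
    'rV[R]_n :=
  \row_(i < n) 'D_(delta_mx ord0 i) f x.

(* On a finite-dimensional V, continuity of z |-> 'd f z v for every v is the
   same as continuity of the differential in operator norm. *)
Definition C1 {R : realType} {V : normedModType R} (f : V -> R) : Prop :=
  (forall z, differentiable f z) /\
  (forall v, continuous (fun z => 'd f z v : R)).

Definition strictly_convex {R : realType} {n : nat} (f : 'rV[R]_n -> R) :
    Prop :=
  forall (p q : 'rV[R]_n) (l : R), p != q -> 0 < l < 1 ->
    f (l *: p + (1 - l) *: q) < l * f p + (1 - l) * f q.

Definition semiconcave {R : realType} {n : nat} (V : set 'rV[R]_n)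
    (u : 'rV[R]_n -> R) : Prop :=
  exists2 C : R, 0 < C &
    forall (x y : 'rV[R]_n) (l : R), V x -> V y -> 0 <= l <= 1 ->
      l * u x + (1 - l) * u y - u (l *: x + (1 - l) *: y)
        <= C / 2 * (l * (1 - l)) * enorm (x - y) ^+ 2.

(* A function on Omega is represented by a total function, of which only the
   values on Omega matter. *)
Definition locally_semiconcave {R : realType} {n : nat}
    (Omega : set 'rV[R]_n) (u : 'rV[R]_n -> R) : Prop :=
  forall x, Omega x ->
    exists r : R, [/\ 0 < r, eball x r `<=` Omega & semiconcave (eball x r) u].

Definition superdiff {R : realType} {n : nat} (u : 'rV[R]_n -> R)
    (x : 'rV[R]_n) : set 'rV[R]_n :=
  [set p | (limf_esup
             (fun y => ((u y - u x - dot p (y - x)) / enorm (y - x))%:E)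
             x^' <= 0)%E].

Definition Sigma {R : realType} {n : nat} (Omega : set 'rV[R]_n)
    (u : 'rV[R]_n -> R) : set 'rV[R]_n :=
  [set x | Omega x /\ ~ (exists p, superdiff u x = [set p])].

Definition row2 {R : realType} (z : R * R) : 'rV[R]_2 :=
  \row_(i < 2) if i == ord0 then z.1 else z.2.

(* The equation holds at x when u is differentiable at x and the gradient
   satisfies it; "almost every" refers to Lebesgue measure on R^2, i.e. the
   product measure on R * R, transported to row vectors by row2. *)
Definition viscosity_solution {R : realType}
    (H : 'rV[R]_2 -> 'rV[R]_2 -> R -> R) (Omega : set 'rV[R]_2)
    (u : 'rV[R]_2 -> R) : Prop :=
  locally_semiconcave Omega u /\
  {ae (@lebesgue_measure R \x @lebesgue_measure R)%E, forall z : R * R,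
     Omega (row2 z) ->
     differentiable u (row2 z) /\
     H (row2 z) (grad u (row2 z)) (u (row2 z)) = 0}.

(* The minimizer of H(x, ., u(x)) on the superdifferential (default value 0
   when there is none). *)
Definition psharp {R : realType} {n : nat}
    (H : 'rV[R]_n -> 'rV[R]_n -> R -> R) (u : 'rV[R]_n -> R)
    (x : 'rV[R]_n) : 'rV[R]_n :=
  xget 0 [set p | superdiff u x p /\
                  forall q, superdiff u x q -> H x p (u x) <= H x q (u x)].

Definition vsharp {R : realType} {n : nat}
    (H : 'rV[R]_n -> 'rV[R]_n -> R -> R) (u : 'rV[R]_n -> R)
    (x : 'rV[R]_n) : 'rV[R]_n :=
  grad (fun p => H x p (u x)) (psharp H u x).

(* Main.v *)
Require Import Defs.
From HB Require Import structures.
From mathcomp Require Import all_boot all_order all_algebra.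
From mathcomp Require Import all_classical all_reals all_analysis.
From mathcomp Require Import ring lra.

Import Order.TTheory GRing.Theory Num.Theory.
Import numFieldNormedType.Exports.

Local Open Scope classical_set_scope.
Local Open Scope ring_scope.

(** Near a point of [Omega] the function [u] is Lipschitz and lies below each of its
    supporting paraboloids with a uniform constant, so the superdifferential is nonempty,
    bounded, convex, has a closed graph and is monotone up to a quadratic term. The equation
    holds on a dense set of points of differentiability. Taking limits of the gradients
    there gives [slope_reached]: in every direction [v], the slope of [u] is bounded below by
    [dot q v] for some [q] in the superdifferential with [H = 0]. By convexity of [H] it
    follows that [H <= 0] on all superdifferentials and, by strict convexity, that [x] is
    singular exactly when [H] takes a negative value on the superdifferential at [x]
    ([SigmaP]). So a point is shown to be singular by finding an element of its
    superdifferential at which [H] is negative.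

    Let [x] be singular, [p0] the minimizer of [H] on its superdifferential, [v] the gradient
    of [H] there. If [v = 0] a constant curve works. Otherwise [p0] minimizes [dot _ v] on the
    superdifferential, and in a thin cone at [x] around [v] all superdifferentials are close
    to the line through [p0] orthogonal to [v] ([cone_band]). On that line [H] is negative
    near [p0], so the superdifferential at [x] extends to both sides of [p0]
    ([face_reached]). Hence on each short segment across the cone there is a point whose
    superdifferential contains an element with the same component as [p0] along the segment
    ([crossing_exists]): this is where [u] switches from the gradients on one side of [p0] to
    those on the other side. At such a point the minimizer of [H] is close to [p0], as [p0]
    is the strict minimum of [H] on the line ([psharp_near]). Monotonicity of the
    superdifferential shows that these points form a Lipschitz graph over the axis of the
    cone ([crossing_lipschitz]).

    The graph is differentiable from the right because the construction can be repeated at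
    each of its points [y], with the same transversal direction: it produces singular points
    in arbitrarily thin cones at [y] around [v#(y)], their superdifferentials contain an element
    whose transversal component is close to that of [p0], and by uniqueness they lie on the
    graph. So the right tangent at [y] has the
    direction [v#(y)], and [v#] is continuous from the right along the graph
    ([singular_graph]). It remains to parametrize the graph with the speed [v#], which is
    only right-continuous: the time needed to reach a point is an integral, and the curve is
    obtained by inverting it ([time_change]). *)

(** * Euclidean plane and superdifferential *)

Section Plane.
Context {R : realType}.
Implicit Types (x y z p q v w d : 'rV[R]_2) (a b l : R).

Lemma dot2E x y : dot x y = x 0 0 * y 0 0 + x 0 1 * y 0 1.
Proof.
rewrite /dot big_ord_recl big_ord1.
by have -> : lift ord0 (ord0 : 'I_1) = 1 :> 'I_2 by apply/val_inj.
Qed.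

Lemma dotC x y : dot x y = dot y x.
Proof. by rewrite !dot2E; ring. Qed.

Lemma dotDl x y z : dot (x + y) z = dot x z + dot y z.
Proof. by rewrite !dot2E !mxE; ring. Qed.

Lemma dotNl x z : dot (- x) z = - dot x z.
Proof. by rewrite !dot2E !mxE; ring. Qed.

Lemma dotZl a x z : dot (a *: x) z = a * dot x z.
Proof. by rewrite !dot2E !mxE; ring. Qed.

Lemma dotDr x y z : dot z (x + y) = dot z x + dot z y.
Proof. by rewrite !(dotC z) dotDl. Qed.

Lemma dotNr x z : dot z (- x) = - dot z x.
Proof. by rewrite !(dotC z) dotNl. Qed.

Lemma dotZr a x z : dot z (a *: x) = a * dot z x.
Proof. by rewrite !(dotC z) dotZl. Qed.

Lemma dot0l x : dot 0 x = 0.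
Proof. by rewrite dot2E !mxE; ring. Qed.

Lemma dot0r x : dot x 0 = 0.
Proof. by rewrite dotC dot0l. Qed.

Definition dotE := (dotDl, dotNl, dotZl, dotDr, dotNr, dotZr, dot0l, dot0r).

Lemma row2_eq x y : x 0 0 = y 0 0 -> x 0 1 = y 0 1 -> x = y.
Proof.
move=> h0 h1; apply/rowP => -[[|[|//]] i2].
  by have -> : Ordinal i2 = 0 by apply/val_inj.
by have -> : Ordinal i2 = 1 by apply/val_inj.
Qed.

Lemma coord_le_norm x i : `|x 0 i| <= `|x|.
Proof.
rewrite -[leRHS]/(mx_norm x) mx_normrE; apply/bigmax_geP; right => /=.
by exists (0, i).
Qed.

Lemma norm_le_coord x b : `|x 0 0| <= b -> `|x 0 1| <= b -> `|x| <= b.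
Proof.
move=> h0 h1; rewrite -[leLHS]/(mx_norm x) mx_normrE; apply/bigmax_leP; split.
  exact: le_trans h0.
move=> [i j] _ /=; rewrite (ord1 i).
case: j => -[|[|//]] j2.
  by have -> : Ordinal j2 = 0 by apply/val_inj.
by have -> : Ordinal j2 = 1 by apply/val_inj.
Qed.

Lemma dot_ge0 x : 0 <= dot x x.
Proof. by rewrite dot2E addr_ge0// -expr2 sqr_ge0. Qed.

Lemma dot_gt0 x : x != 0 -> 0 < dot x x.
Proof.
move=> x0; rewrite lt_neqAle dot_ge0 andbT; apply: contra x0 => /eqP.
rewrite dot2E => h; apply/eqP/row2_eq; rewrite !mxE; nra.
Qed.

Lemma ler_dot x y : `|dot x y| <= 2 * (`|x| * `|y|).
Proof.
rewrite dot2E; have -> : 2 * (`|x| * `|y|) = `|x| * `|y| + `|x| * `|y| by ring.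
by apply: (le_trans (ler_normD _ _)); apply: lerD; rewrite normrM ler_pM// coord_le_norm.
Qed.

Lemma sqr_norm_le_dot x : `|x| ^+ 2 <= dot x x.
Proof.
have h : `|x| <= Num.sqrt (dot x x).
  by apply: norm_le_coord; rewrite -sqrtr_sqr ler_wsqrtr// dot2E !expr2;
    rewrite ?lerDl ?lerDr -expr2 sqr_ge0.
by rewrite -[leRHS]sqr_sqrtr ?dot_ge0// ler_pXn2r// nnegrE// sqrtr_ge0.
Qed.

Lemma enorm_sqr x : enorm x ^+ 2 = dot x x.
Proof. by rewrite sqr_sqrtr// dot_ge0. Qed.

Lemma norm_le_enorm x : `|x| <= enorm x.
Proof.
by rewrite -[leLHS]ger0_norm// -sqrtr_sqr ler_wsqrtr// sqr_norm_le_dot.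
Qed.

Lemma enorm_le_norm x : enorm x <= 2 * `|x|.
Proof.
have h2 : 0 <= 2 * `|x| by rewrite mulr_ge0.
rewrite -[leRHS](ger0_norm h2) -sqrtr_sqr ler_wsqrtr//.
apply: (le_trans (ler_norm _)); apply: (le_trans (ler_dot _ _)).
rewrite expr2; have := normr_ge0 x; nra.
Qed.

(** Rotation by a quarter turn. *)
Definition rot v : 'rV[R]_2 := row2 (- v 0 1, v 0 0).

Lemma rotE v : (rot v 0 0 = - v 0 1) * (rot v 0 1 = v 0 0).
Proof. by rewrite !mxE. Qed.

Lemma dot_rot v : dot (rot v) v = 0.
Proof. by rewrite dot2E !rotE; ring. Qed.

Lemma rot_decomp v d : v != 0 ->
  d = (dot d v / dot v v) *: v + (dot d (rot v) / dot v v) *: rot v.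
Proof.
move=> v0; have := dot_gt0 _ v0; rewrite !dot2E => h.
by apply: row2_eq; rewrite !mxE/=; field; rewrite gt_eqF.
Qed.

(** When [v] and [w] are independent, [rot v] and [rot w] form a basis, in which the
coordinates of [d] are proportional to [dot d w] and [dot d v]. *)
Lemma dot_pair_bound v w : dot (rot v) w != 0 ->
  exists2 K : R, 0 < K & forall d, `|d| <= K * (`|dot d v| + `|dot d w|).
Proof.
move=> D0; set D := dot (rot v) w in D0 *.
exists (1 + (`|rot v| + `|rot w|) / `|D|) => [|d].
  by rewrite ltr_pwDl// divr_ge0// addr_ge0.
have D0' : - v 0 1 * w 0 0 + v 0 0 * w 0 1 != 0.
  by move: D0; rewrite /D dot2E !rotE.
have dE : d = (dot d w / D) *: rot v - (dot d v / D) *: rot w.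
  by apply: row2_eq; rewrite /D !dot2E !mxE/=; field.
rewrite {1}dE; set a := dot d w; set b := dot d v.
apply: (le_trans (ler_normB _ _)); rewrite !normrZ !normfV.
have : 0 < `|D| by rewrite normr_gt0.
set x := `|a|; set y := `|b|; set e := `|D|; set V := `|rot v|; set W := `|rot w| => e0.
have [x0 y0] : 0 <= x /\ 0 <= y by rewrite !normr_ge0.
have [V0 W0] : 0 <= V /\ 0 <= W by rewrite !normr_ge0.
have ei : 0 < e^-1 by rewrite invr_gt0.
have := mulr_ge0 (mulr_ge0 y0 (ltW ei)) V0.
have := mulr_ge0 (mulr_ge0 x0 (ltW ei)) W0.
nra.
Qed.

Lemma convex_comb_norm (l a b e : R) : 0 <= l <= 1 -> `|a| <= e -> `|b| <= e ->
  `|l * a + (1 - l) * b| <= e.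
Proof.
move=> /andP[l0 l1] ae be; apply: (le_trans (ler_normD _ _)).
rewrite !normrM (ger0_norm l0) (@ger0_norm _ (1 - l)) ?subr_ge0//.
have l1' : 0 <= 1 - l by rewrite subr_ge0.
by have := ler_wpM2l l0 ae; have := ler_wpM2l l1' be; lra.
Qed.

Implicit Type u : 'rV[R]_2 -> R.

(** The epsilon form of the upper limit. The sup norm may replace the Euclidean one, as each
is at most twice the other. *)
Lemma superdiffP u x p : superdiff u x p <->
  forall e, 0 < e -> exists2 dl : R, 0 < dl & forall y, `|y - x| < dl ->
    u y - u x - dot p (y - x) <= e * `|y - x|.
Proof.
split=> [sp e e0|h].
- have e2 : ((0 : R)%:E < (e / 2)%:E)%E by rewrite lte_fin divr_gt0.
  have := le_lt_trans sp e2; rewrite /limf_esup => /ereal_inf_lt [_ [V xV <-]] sV.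
  have [/= dl dl0 hdl] := (nbhs_ballP _ _).1 xV; exists dl => // y xy.
  have [->|yx] := eqVneq y x; first by rewrite !subrr dot0r subr0 normr0 mulr0.
  have Vy : V y by apply: hdl => //; rewrite -ball_normE /= distrC.
  have := le_lt_trans (ereal_sup_ubound (imageP _ Vy)) sV; rewrite lte_fin.
  have yx' : 0 < `|y - x| by rewrite normr_gt0 subr_eq0.
  have ey : 0 < enorm (y - x) := lt_le_trans yx' (norm_le_enorm _).
  rewrite ltr_pdivrMr// => /ltW /le_trans; apply.
  rewrite -mulrA ler_wpM2l// ?(ltW e0)// ler_pdivrMl//; exact: enorm_le_norm.
- rewrite /superdiff/=; apply/lee_addgt0Pr => e e0; rewrite add0e.
  have [dl dl0 hdl] := h _ e0.
  pose V := [set y | `|y - x| < dl /\ y != x].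
  apply: (@le_trans _ _ (ereal_sup [set
      ((u y - u x - dot p (y - x)) / enorm (y - x))%:E | y in V])).
    apply: ereal_inf_lbound; exists V => //.
    apply/nbhs_ballP; exists dl => //= y; rewrite -ball_normE/= distrC => xy yx.
    by split.
  apply: ge_ereal_sup => _ [y [xy yx] <-]; rewrite lee_fin.
  have yx' : 0 < `|y - x| by rewrite normr_gt0 subr_eq0.
  have ey : 0 < enorm (y - x) := lt_le_trans yx' (norm_le_enorm _).
  rewrite ler_pdivrMr//; apply: (le_trans (hdl _ xy)).
  by rewrite ler_wpM2l// ?(ltW e0)// norm_le_enorm.
Qed.

End Plane.

(** * Local estimates for semiconcave functions *)

Section LocalBounds.
Context {R : realType}.
Implicit Types (x y z p q v w d : 'rV[R]_2) (a b l : R) (Omega : set 'rV[R]_2).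
Implicit Type u : 'rV[R]_2 -> R.

Lemma bounded_cluster (M : R) (A : R -> set 'rV[R]_2) :
  (forall t, 0 < t -> exists2 p, `|p| <= M & A t p) ->
  exists2 p, `|p| <= M & forall e, 0 < e ->
    exists t, exists2 q, 0 < t < e & A t q /\ `|q - p| < e.
Proof.
move=> hA; pose B := [set p : 'rV[R]_2 | `|p| <= M].
have cB : compact B.
  apply: bounded_closed_compact.
    by exists M; split; [exact: num_real | move=> N MN p /= /le_trans; apply; exact: ltW].
  rewrite (_ : B = (fun p => `|p|) @^-1` [set r | r <= M])//.
  by apply: preimage_closed; [move=> ? _; exact: norm_continuous | exact: closed_le].
have pos n : (0 : R) < n.+1%:R^-1 by rewrite invr_gt0.
pose f n := sval (cid2 (hA _ (pos n))).
have fP n : B (f n) /\ A n.+1%:R^-1 (f n) by rewrite /f; case: cid2.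
have [|p [Bp cp]] := cB (f @ \oo) _; first by exists 0%N => // n _; have [] := fP n.
exists p => // e e0.
have Nn : (f @ \oo) [set f n | n in [set n | n.+1%:R^-1 < e]].
  have [N _ hN] := @near_infty_natSinv_lt R (PosNum e0).
  by exists N => // n /hN /= h; exists n.
have [q [[n /= ne <-] pq]] := cp _ _ Nn (nbhsx_ballx p e e0).
exists n.+1%:R^-1, (f n); first by rewrite pos.
split; first by have [] := fP n.
by move: pq; rewrite -ball_normE /= distrC.
Qed.

Lemma semiconcave_cube {Omega u x} : locally_semiconcave Omega u -> Omega x ->
  exists r C : R, [/\ 0 < r, 0 < C, forall y, `|y - x| < r -> Omega y &
    forall y z l, `|y - x| < r -> `|z - x| < r -> 0 <= l <= 1 ->
      l * u y + (1 - l) * u z - u (l *: y + (1 - l) *: z)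
        <= C * (l * (1 - l)) * `|y - z| ^+ 2].
Proof.
move=> lu xO; have [r [r0 rO [C C0 hC]]] := lu x xO.
have sub y : `|y - x| < r / 2 -> eball x r y.
  by move=> h; rewrite /eball/=; apply: le_lt_trans (enorm_le_norm _) _; lra.
exists (r / 2), C; split => //; first by lra.
  by move=> y /sub /rO.
move=> y z l /sub yr /sub zr l01; apply: (le_trans (hC _ _ _ yr zr l01)).
rewrite enorm_sqr.
have h : dot (y - z) (y - z) <= 2 * `|y - z| ^+ 2.
  by apply: (le_trans (ler_norm _)); rewrite expr2; exact: ler_dot.
have Cl : 0 <= C / 2 * (l * (1 - l)) by rewrite mulr_ge0//; [lra|nra].
by apply: (le_trans (ler_wpM2l Cl h)); rewrite le_eqVlt; apply/orP; left; apply/eqP; field.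
Qed.

(** A function that is semiconcave near a point is bounded near it: from below by its
values at the corners of a square, hence from above by reflection in the centre. *)
Lemma semiconcave_bounded {Omega u x} : locally_semiconcave Omega u -> Omega x ->
  exists r B : R, [/\ 0 < r, 0 < B & forall y, `|y - x| <= r -> `|u y| <= B].
Proof.
move=> lu xO; have [r [C [r0 C0 _ sc]]] := semiconcave_cube lu xO.
pose s := r / 2; have s0 : 0 < s by rewrite /s; lra.
have sr : s < r by rewrite /s; lra.
pose P a b : 'rV[R]_2 := x + row2 (a, b).
have Pn a b : `|a| <= s -> `|b| <= s -> `|P a b - x| <= s.
  by move=> ha hb; rewrite /P addrC addKr; apply: norm_le_coord; rewrite !mxE.
have Ps a b : `|a| <= s -> `|b| <= s -> `|P a b - x| < r.
  by move=> ha hb; exact: le_lt_trans (Pn _ _ ha hb) sr.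
pose E := C * (s * 2) ^+ 2; have E0 : 0 <= E by rewrite mulr_ge0// ?sqr_ge0// ltW.
have seg y z l m : `|y - x| <= s -> `|z - x| <= s -> 0 <= l <= 1 ->
    m <= u y -> m <= u z -> m - E <= u (l *: y + (1 - l) *: z).
  move=> hy hz l01 my mz.
  have := sc y z l (le_lt_trans hy sr) (le_lt_trans hz sr) l01.
  have yz : `|y - z| <= s * 2.
    have -> : y - z = (y - x) - (z - x) by rewrite opprB addrA subrK.
    by apply: (le_trans (ler_normB _ _)); lra.
  have yz2 : `|y - z| ^+ 2 <= (s * 2) ^+ 2 by rewrite ler_pXn2r// nnegrE//; lra.
  have : C * (l * (1 - l)) * `|y - z| ^+ 2 <= E.
    rewrite /E -mulrA ler_wpM2l ?(ltW C0)//.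
    have ll : 0 <= l * (1 - l) <= 1 by nra.
    apply: (@le_trans _ _ (1 * `|y - z| ^+ 2)); last by rewrite mul1r.
    by rewrite ler_wpM2r ?sqr_ge0//; lra.
  have := ler_wpM2l (_ : 0 <= l) my; have := ler_wpM2l (_ : 0 <= 1 - l) mz.
  move=> /(_ ltac:(lra)) h1 /(_ ltac:(lra)) h2 h3 h4; lra.
have Pmix0 a b c l : l *: P a c + (1 - l) *: P b c = P (l * a + (1 - l) * b) c.
  by apply: row2_eq; rewrite !mxE/=; ring.
have Pmix1 a b c l : l *: P c a + (1 - l) *: P c b = P c (l * a + (1 - l) * b).
  by apply: row2_eq; rewrite !mxE/=; ring.
pose m := Num.min (Num.min (u (P s s)) (u (P (- s) s)))
                  (Num.min (u (P s (- s))) (u (P (- s) (- s)))).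
have ns : `|s| <= s by rewrite ger0_norm// ltW.
have nsN : `|- s| <= s by rewrite normrN.
pose lam a := (a + s) / (s * 2).
have lam01 a : `|a| <= s -> 0 <= lam a <= 1.
  rewrite ler_norml /lam => h; rewrite divr_ge0; [|lra|lra].
  by rewrite ler_pdivrMr; [lra|lra].
have lamE a : lam a * s + (1 - lam a) * (- s) = a by rewrite /lam; field; lra.
have edge a c : `|a| <= s -> (c = s \/ c = - s) -> m - E <= u (P a c).
  move=> ha hc; rewrite -(lamE a) -Pmix0.
  have hcs : `|c| <= s by case: hc => ->.
  apply: seg; [exact: Pn|exact: Pn|exact: lam01| |].
    by case: hc => ->; rewrite /m !ge_min lexx ?orbT.
  by case: hc => ->; rewrite /m !ge_min lexx ?orbT.
have low y : `|y - x| <= s -> m - E - E <= u y.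
  move=> hy; pose a := (y - x) 0 0; pose b := (y - x) 0 1.
  have ha : `|a| <= s by exact: le_trans (coord_le_norm _ _) hy.
  have hb : `|b| <= s by exact: le_trans (coord_le_norm _ _) hy.
  have -> : y = P a b by apply: row2_eq; rewrite !mxE/= /a /b !mxE; ring.
  rewrite -(lamE b) -Pmix1; apply: seg; [exact: Pn|exact: Pn|exact: lam01| |].
    by apply: edge => //; left.
  by apply: edge => //; right.
have up y : `|y - x| <= s -> u y <= u x * 2 - (m - E - E) + E * 2.
  move=> hy; have hy' : `|x + x - y - x| <= s.
    by rewrite (_ : x + x - y - x = - (y - x)) ?normrN//; apply: row2_eq; rewrite !mxE; ring.
  have h01 : 0 <= (2^-1 : R) <= 1 by lra.
  have h := sc y (x + x - y) 2^-1 (le_lt_trans hy sr) (le_lt_trans hy' sr) h01.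
  have hx : 2^-1 *: y + (1 - 2^-1) *: (x + x - y) = x.
    by apply: row2_eq; rewrite !mxE; field.
  rewrite hx in h; have := low _ hy'.
  have yz : `|y - (x + x - y)| <= s * 2.
    have -> : y - (x + x - y) = 2 *: (y - x).
      by apply: row2_eq; rewrite !mxE; ring.
    by rewrite normrZ ger0_norm// mulrC ler_wpM2r.
  have yz2 : `|y - (x + x - y)| ^+ 2 <= (s * 2) ^+ 2 by rewrite ler_pXn2r// nnegrE//; lra.
  have : C * (2^-1 * (1 - 2^-1)) * `|y - (x + x - y)| ^+ 2 <= E.
    apply: (@le_trans _ _ (C * `|y - (x + x - y)| ^+ 2)); last by rewrite ler_wpM2l// ltW.
    by rewrite ler_wpM2r ?sqr_ge0//; lra.
  by lra.
exists s, (`|m - E - E| + `|u x * 2 - (m - E - E) + E * 2| + 1); split => //.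
move=> y hy; have := low _ hy; have := up _ hy; rewrite ler_norml.
set A := m - E - E; set B := _ + E * 2 => h1 h2.
have := ler_norm B; have := ler_norm (- A); rewrite normrN.
have := normr_ge0 A; have := normr_ge0 B; lra.
Qed.

(** Prolong the segment from [y] to [z] by a fixed length beyond [z]: semiconcavity on the longer
segment bounds [u y - u z] by a multiple of [`|z - y|] times the oscillation of [u]. *)
Lemma semiconcave_lipschitz {Omega u x} : locally_semiconcave Omega u -> Omega x ->
  exists r K : R, [/\ 0 < r, 0 < K & forall y z, `|y - x| < r -> `|z - x| < r ->
    u y - u z <= K * `|y - z|].
Proof.
move=> lu xO; have [r [C [r0 C0 sub sc]]] := semiconcave_cube lu xO.
have [s' [B [s'0 B0 hB]]] := semiconcave_bounded lu xO.
pose s := Num.min s' (r / 2).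
have s0 : 0 < s by rewrite /s lt_min s'0 divr_gt0.
have sr : s < r by rewrite /s gt_min; apply/orP; right; lra.
have uB y : `|y - x| <= s -> `|u y| <= B.
  by move=> h; apply: hB; apply: le_trans h _; rewrite /s ge_min lexx.
clearbody s.
pose K := (2 * B + C * (s * 2) ^+ 2) * (2 / s).
have BC : 0 <= 2 * B + C * (s * 2) ^+ 2 by rewrite addr_ge0 ?mulr_ge0 ?sqr_ge0// ltW.
have K0 : 0 < K.
  by rewrite mulr_gt0// ?divr_gt0// ltr_pwDl ?mulr_ge0// ?sqr_ge0 ?ltW// mulr_gt0.
exists (s / 2), K; split; [by rewrite divr_gt0|exact: K0|].
move=> y z hy hz; have [->|yz] := eqVneq y z; first by rewrite !subrr normr0 mulr0.
have d0 : 0 < `|z - y| by rewrite normr_gt0 subr_eq0 eq_sym.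
rewrite (distrC y z).
have [d dE] : exists d : R, d = `|z - y| by exists `|z - y|.
rewrite -dE in d0 *.
pose e := z + (s / 2 / d) *: (z - y).
have ez : `|e - z| = s / 2.
  rewrite /e addrC addKr normrZ ger0_norm ?divr_ge0// ?ltW// -dE divfK ?gt_eqF//.
have ex : `|e - x| <= s.
  have -> : e - x = (e - z) + (z - x) by rewrite addrA subrK.
  by apply: (le_trans (ler_normD _ _)); move: ez hz; clear; lra.
have yx : `|y - x| <= s by move: hy s0; clear; lra.
pose l := d / (d + s / 2).
have ds : 0 < d + s / 2 by rewrite addr_gt0// divr_gt0.
have l01 : 0 <= l <= 1.
  rewrite /l divr_ge0 ?(ltW d0) ?(ltW ds)//= ler_pdivrMr// mul1r lerDl divr_ge0// ltW//.
have zE : l *: e + (1 - l) *: y = z.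
  by apply: row2_eq; rewrite /e /l !mxE; field; rewrite !gt_eqF// addr_gt0// mulr_gt0.
have h2 : l <= d * (2 / s).
  rewrite /l ler_pdivrMr//.
  have -> : d * (2 / s) * (d + s / 2) = d + d * (d * (2 / s)) by field; rewrite gt_eqF.
  by rewrite lerDl !mulr_ge0 ?invr_ge0 ?(ltW d0) ?(ltW s0).
clearbody e l.
have := sc e y l (le_lt_trans ex sr) (le_lt_trans yx sr) l01; rewrite zE.
have ey : `|e - y| <= s * 2.
  have -> : e - y = (e - x) - (y - x) by rewrite opprB addrA subrK.
  by apply: (le_trans (ler_normB _ _)); move: ex yx; clear; lra.
have ey2 : `|e - y| ^+ 2 <= (s * 2) ^+ 2.
  by rewrite ler_pXn2r// nnegrE// mulr_ge0// ltW.
case/andP: (l01) => l0 l1; have l1' : 0 <= 1 - l by rewrite subr_ge0.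
have h1 : C * (l * (1 - l)) * `|e - y| ^+ 2 <= l * (C * (s * 2) ^+ 2).
  have -> : C * (l * (1 - l)) * `|e - y| ^+ 2 = l * (C * ((1 - l) * `|e - y| ^+ 2)).
    by ring.
  rewrite ler_wpM2l// ler_wpM2l ?(ltW C0)//; apply: (le_trans _ ey2).
  by rewrite -[leRHS]mul1r ler_wpM2r ?sqr_ge0// gerBl.
have := uB _ ex; have := uB _ yx; rewrite !ler_norml => uy ue.
have h3 : l * (u y - u e) <= l * (2 * B).
  by rewrite ler_wpM2l//; move: uy ue; clear; lra.
have h4 : l * (2 * B + C * (s * 2) ^+ 2) <= d * (2 / s) * (2 * B + C * (s * 2) ^+ 2).
  by rewrite ler_wpM2r.
by rewrite /K; move: h1 h3 h4; clear; lra.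
Qed.

Lemma lipschitz_superdiff_bounded u x p (r K : R) : 0 < r ->
  (forall z, `|z - x| < r -> u x - u z <= K * `|x - z|) -> 0 <= K ->
  superdiff u x p -> `|p| <= K + 1.
Proof.
move=> r0 lip K0 /superdiffP /(_ 1 ltr01) [dl dl0 hdl].
pose t := Num.min (dl / 2) (r / 2).
have t0 : 0 < t by rewrite /t lt_min !divr_gt0.
have tdl : t < dl by rewrite /t gt_min; apply/orP; left; lra.
have tr : t < r by rewrite /t gt_min; apply/orP; right; lra.
suff key d : `|d| <= 1 -> - dot p d <= K + 1.
  apply: norm_le_coord; rewrite ler_norml; apply/andP; split.
  - have := key (row2 (1, 0)); rewrite dot2E !mxE/= mulr1 mulr0 addr0 lerNl; apply.
    by apply: norm_le_coord; rewrite !mxE/= ?normr0 ?normr1.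
  - have := key (row2 (-1, 0)); rewrite dot2E !mxE/= mulrN1 mulr0 addr0 opprK; apply.
    by apply: norm_le_coord; rewrite !mxE/= ?normr0 ?normrN1.
  - have := key (row2 (0, 1)); rewrite dot2E !mxE/= mulr1 mulr0 add0r lerNl; apply.
    by apply: norm_le_coord; rewrite !mxE/= ?normr0 ?normr1.
  - have := key (row2 (0, -1)); rewrite dot2E !mxE/= mulrN1 mulr0 add0r opprK; apply.
    by apply: norm_le_coord; rewrite !mxE/= ?normr0 ?normrN1.
move=> d1; pose z := x + t *: d.
have zx : z - x = t *: d by rewrite /z addrC addKr.
have nzx : `|z - x| <= t.
  by rewrite zx normrZ (gtr0_norm t0) -[leRHS]mulr1 ler_wpM2l// ltW.
have := hdl z (le_lt_trans nzx tdl); rewrite mul1r zx dotZr -zx => h.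
have := lip z (le_lt_trans nzx tr); rewrite (distrC x z) => h'.
have h'' : K * `|z - x| <= K * t by rewrite ler_wpM2l.
have : t * (- dot p d) <= t * (K + 1) by lra.
by rewrite ler_pM2l.
Qed.

(** Apply semiconcavity on the segment from [y] to [z] at a point that tends to [y], where the
increment of [u] is controlled by [p]. *)
Lemma semiconcave_tangent u y z p (C : R) : 0 <= C ->
  (forall l, 0 <= l <= 1 -> l * u z + (1 - l) * u y - u (l *: z + (1 - l) *: y)
     <= C * (l * (1 - l)) * `|z - y| ^+ 2) ->
  superdiff u y p -> u z <= u y + dot p (z - y) + C * `|z - y| ^+ 2.
Proof.
move=> C0 sc sp; apply/ler_addgt0Pr => e e0.
have [->|yz] := eqVneq z y.
  by rewrite !subrr dot0r normr0 expr2 mulr0 mulr0 !addr0 lerDl ltW.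
have d0 : 0 < `|z - y| by rewrite normr_gt0 subr_eq0.
have ed : 0 < e / `|z - y| by rewrite divr_gt0.
have [dl dl0 hdl] := (superdiffP _ _ _).1 sp _ ed.
pose l := Num.min 1 (dl / 2 / `|z - y|).
have l0 : 0 < l by rewrite /l lt_min ltr01 !divr_gt0.
have l1 : l <= 1 by rewrite /l ge_min lexx.
have ldl : l * `|z - y| < dl.
  apply: (@le_lt_trans _ _ (dl / 2 / `|z - y| * `|z - y|)).
    by rewrite ler_wpM2r// /l ge_min lexx orbT.
  by rewrite divfK ?gt_eqF//; lra.
have l01 : 0 <= l <= 1 by rewrite ltW.
have := sc l l01; pose yl := l *: z + (1 - l) *: y; rewrite -/yl.
have yly : yl - y = l *: (z - y).
  by rewrite /yl scalerBl scale1r addrCA addrC addrK scalerBr.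
have nyl : `|yl - y| = l * `|z - y| by rewrite yly normrZ ger0_norm// ltW.
have := hdl yl; rewrite nyl => /(_ ldl); rewrite yly dotZr.
have -> : e / `|z - y| * (l * `|z - y|) = l * e by rewrite mulrCA divfK ?gt_eqF.
move=> h1 h2.
have h3 : C * (l * (1 - l)) * `|z - y| ^+ 2 <= l * (C * `|z - y| ^+ 2).
  have -> : C * (l * (1 - l)) * `|z - y| ^+ 2 = l * (C * `|z - y| ^+ 2) * (1 - l) by ring.
  by rewrite -[leRHS]mulr1 ler_wpM2l ?mulr_ge0 ?sqr_ge0 ?(ltW l0)// gerBl ltW.
rewrite -(ler_pM2l l0); move: h1 h2 h3; clear; lra.
Qed.

(** A single constant [C] serves for the three estimates, the Lipschitz bound, the bound on
the superdifferentials and the supporting paraboloids. *)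
Record local_bounds Omega u x (r C : R) : Prop := LocalBounds {
  lb_r : 0 < r;
  lb_C : 0 < C;
  lb_sub : forall y, `|y - x| < r -> Omega y;
  lb_lip : forall y z, `|y - x| < r -> `|z - x| < r -> u y - u z <= C * `|y - z|;
  lb_bd : forall y p, `|y - x| < r -> superdiff u y p -> `|p| <= C;
  lb_tan : forall y z p, `|y - x| < r -> `|z - x| < r -> superdiff u y p ->
    u z <= u y + dot p (z - y) + C * `|z - y| ^+ 2 }.

Lemma local_boundsP {Omega u x} : locally_semiconcave Omega u -> Omega x ->
  exists r C, local_bounds Omega u x r C.
Proof.
move=> lu xO; have [r [C [r0 C0 sub sc]]] := semiconcave_cube lu xO.
have [s [K [s0 K0 lip]]] := semiconcave_lipschitz lu xO.
have K1 : K <= K + 1 + C by lra.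
have K2 : C <= K + 1 + C by lra.
have hmin y : `|y - x| < Num.min r s -> `|y - x| < r /\ `|y - x| < s.
  by rewrite lt_min => /andP.
exists (Num.min r s), (K + 1 + C); split.
- by rewrite lt_min r0.
- by rewrite !addr_gt0.
- by move=> y /hmin[/sub].
- move=> y z /hmin[_ ys] /hmin[_ zs]; apply: (le_trans (lip y z ys zs)).
  by rewrite ler_wpM2r.
- move=> y p /hmin[_ ys] sp.
  have sy : 0 < s - `|y - x| by rewrite subr_gt0.
  have ly z : `|z - y| < s - `|y - x| -> u y - u z <= K * `|y - z|.
    move=> zy; apply: lip => //; have -> : z - x = (z - y) + (y - x) by rewrite addrA subrK.
    by apply: (le_lt_trans (ler_normD _ _)); rewrite -ltrBrDr.
  apply: (le_trans (lipschitz_superdiff_bounded _ _ _ _ _ sy ly (ltW K0) sp)).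
  by rewrite lerDl ltW.
- move=> y z p /hmin[yr _] /hmin[zr _] sp.
  apply: (le_trans (semiconcave_tangent _ _ _ _ _ (ltW C0) _ sp)).
    by move=> l; exact: sc.
  by rewrite lerD2l ler_wpM2r ?sqr_ge0.
Qed.

End LocalBounds.

(** * Closedness, gradients and density *)

Lemma continuous_atP {R : realType} {V W : normedModType R} (f : V -> W) (x : V) :
  {for x, continuous f} <-> forall e : R, 0 < e -> exists2 dl : R, 0 < dl &
    forall y, `|y - x| < dl -> `|f y - f x| < e.
Proof.
split=> [/cvgrPdist_lt h e e0|h].
  have /nbhs_ballP[dl dl0 hdl] := h _ e0; exists dl => // y yx.
  by rewrite distrC; apply: hdl; rewrite -ball_normE /= distrC.
apply/cvgrPdist_lt => e e0; have [dl dl0 hdl] := h _ e0.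
apply/nbhs_ballP; exists dl => // y; rewrite -ball_normE /= distrC => /hdl.
by rewrite distrC.
Qed.

Lemma differentiable_estimate {R : realType} {V W : normedModType R} (f : V -> W)
    (x : V) : differentiable f x -> forall e : R, 0 < e -> exists2 dl : R, 0 < dl &
  forall y, `|y - x| < dl -> `|f y - f x - 'd f x (y - x)| <= e * `|y - x|.
Proof.
move=> df e e0; have := (eqaddoP _ _ _ _).1 (diff_locally df) _ e0.
move=> /nbhs_ballP [dl dl0 hdl]; exists dl => // y yx.
have /hdl : ball (0 : V) dl (y - x) by rewrite -ball_normE /= sub0r normrN.
by rewrite !fctE /= /shift/= subrK opprD addrA.
Qed.

Section Superdifferential.
Context {R : realType}.
Implicit Types (x y z p q v w d : 'rV[R]_2) (a b l : R) (Omega : set 'rV[R]_2).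
Implicit Type u : 'rV[R]_2 -> R.

Lemma superdiff_of_tangent u x p (r C : R) : 0 < r -> 0 <= C ->
  (forall z, `|z - x| < r -> u z <= u x + dot p (z - x) + C * `|z - x| ^+ 2) ->
  superdiff u x p.
Proof.
move=> r0 C0 h; apply/superdiffP => e e0.
exists (Num.min r (e / (C + 1))); first by rewrite lt_min r0 divr_gt0//; lra.
move=> z; rewrite lt_min => /andP[zr ze].
have := h z zr; have : C * `|z - x| ^+ 2 <= e * `|z - x|; last by lra.
rewrite expr2 mulrA ler_wpM2r//.
move: ze; rewrite ltr_pdivlMr; last by lra.
by have := normr_ge0 (z - x); lra.
Qed.

Lemma superdiff_convex u x p q l : 0 <= l <= 1 ->
  superdiff u x p -> superdiff u x q -> superdiff u x (l *: p + (1 - l) *: q).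
Proof.
move=> l01 /superdiffP hp /superdiffP hq; apply/superdiffP => e e0.
have [a a0 ha] := hp _ e0; have [b b0 hb] := hq _ e0.
exists (Num.min a b); first by rewrite lt_min a0.
move=> y; rewrite lt_min => /andP[ya yb]; rewrite !dotE -?dotDr.
have l0 : 0 <= l by lra.
have l1 : 0 <= 1 - l by lra.
have := ler_wpM2l l0 (ha _ ya); have := ler_wpM2l l1 (hb _ yb).
rewrite !dotE; lra.
Qed.

Lemma superdiff_intermediate u x q1 q2 w (m : R) : superdiff u x q1 -> superdiff u x q2 ->
  dot q1 w <= m <= dot q2 w -> exists2 p, superdiff u x p & dot p w = m.
Proof.
move=> s1 s2 /andP[m1 m2]; have [q12|q12] := eqVneq (dot q1 w) (dot q2 w).
  by exists q1 => //; lra.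
have g : 0 < dot q2 w - dot q1 w by rewrite subr_gt0 lt_neqAle q12 (le_trans m1).
pose l := (dot q2 w - m) / (dot q2 w - dot q1 w).
exists (l *: q1 + (1 - l) *: q2).
  apply: superdiff_convex => //; rewrite /l divr_ge0 ?subr_ge0//; last by rewrite (le_trans m1).
  by rewrite ler_pdivrMr//; lra.
by rewrite !dotE /l; field; rewrite gt_eqF.
Qed.

Lemma locally_semiconcave_continuous Omega u x : locally_semiconcave Omega u ->
  Omega x -> {for x, continuous u}.
Proof.
move=> lu xO; have [r [C [r0 C0 _ lip _ _]]] := local_boundsP lu xO.
apply/continuous_atP => e e0.
exists (Num.min r (e / C)); first by rewrite lt_min r0 divr_gt0.
move=> y; rewrite lt_min ltr_pdivlMr// => /andP[yr ye].
have xr : `|x - x| < r by rewrite subrr normr0.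
have := lip _ _ xr yr; have := lip _ _ yr xr; rewrite (distrC x y) ltr_norml => h1 h2.
apply/andP; split; lra.
Qed.

(** The supporting paraboloids at [y] pass to the limit, as their constant is locally
uniform. *)
Lemma superdiff_closed Omega u x p : locally_semiconcave Omega u -> Omega x ->
  (forall e, 0 < e -> exists y q, [/\ `|y - x| < e, `|q - p| < e & superdiff u y q]) ->
  superdiff u x p.
Proof.
move=> lu xO h; have [r [C [r0 C0 _ lip _ tan]]] := local_boundsP lu xO.
apply: (@superdiff_of_tangent _ _ _ (r / 2) C); [lra|exact: ltW|].
move=> z zr; apply/ler_addgt0Pr => e e0.
pose N := `|z - x|; have N0 : 0 <= N by exact: normr_ge0.
pose M := C + 2 * (N + r) + 2 * (`|p|) + C * (N * 2 + r) + 1.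
have M0 : 0 < M.
  rewrite /M; have := normr_ge0 p; have := mulr_ge0 (ltW C0) N0; have := mulr_gt0 C0 r0; lra.
pose t := Num.min (r / 2) (e / M).
have t0 : 0 < t by rewrite /t lt_min (divr_gt0 e0 M0) andbT; lra.
have tr : t <= r / 2 by rewrite /t ge_min lexx.
have te : t * M <= e by rewrite -ler_pdivlMr// /t ge_min lexx orbT.
have [y [q [yx qp sq]]] := h t t0.
have yr : `|y - x| < r by lra.
have zr' : `|z - x| < r by lra.
have xr : `|x - x| < r by rewrite subrr normr0.
have hz := tan _ _ _ yr zr' sq; have hy := lip _ _ yr xr.
have Dn : dot q (z - y) <= dot p (z - x) + 2 * (t * (N + t)) + 2 * (`|p| * t).
  have -> : dot q (z - y) = dot (q - p) (z - y) + dot p (z - x) + dot p (x - y).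
    by rewrite !dotE; ring.
  have zy : `|z - y| <= N + t.
    have -> : z - y = (z - x) - (y - x) by rewrite opprB addrA subrK.
    by apply: (le_trans (ler_normB _ _)); rewrite lerD2l ltW.
  have h1 : dot (q - p) (z - y) <= 2 * (t * (N + t)).
    apply: (le_trans (ler_norm _)); apply: (le_trans (ler_dot _ _)).
    by rewrite ler_wpM2l// ler_pM// ltW.
  have h2 : dot p (x - y) <= 2 * (`|p| * t).
    apply: (le_trans (ler_norm _)); apply: (le_trans (ler_dot _ _)).
    by rewrite ler_wpM2l// ler_wpM2l// distrC ltW.
  by lra.
have sq2 : `|z - y| ^+ 2 <= N ^+ 2 + t * (N * 2 + t).
  have -> : N ^+ 2 + t * (N * 2 + t) = (N + t) ^+ 2 by ring.
  rewrite ler_pXn2r ?nnegrE//; last by lra.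
  have -> : z - y = (z - x) - (y - x) by rewrite opprB addrA subrK.
  by apply: (le_trans (ler_normB _ _)); rewrite lerD2l ltW.
have hC : C * `|z - y| ^+ 2 <= C * N ^+ 2 + C * (t * (N * 2 + r)).
  rewrite -mulrDr ler_wpM2l ?(ltW C0)//; apply: (le_trans sq2); rewrite lerD2l.
  by rewrite ler_wpM2l ?(ltW t0)//; lra.
have hyx : C * `|y - x| <= C * t by rewrite ler_wpM2l ?(ltW C0)// ltW.
have htt : t * (N + t) <= t * (N + r) by rewrite ler_wpM2l ?(ltW t0)//; lra.
have : t * M = C * t + 2 * (t * (N + r)) + 2 * (`|p| * t) + C * (t * (N * 2 + r)) + t.
  by rewrite /M; ring.
rewrite -/N; lra.
Qed.

Lemma dot_le_cluster p v (m : R) :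
  (forall e, 0 < e -> exists2 q, `|q - p| < e & dot q v <= m + e) -> dot p v <= m.
Proof.
move=> h; apply/ler_addgt0Pr => e e0.
have V0 : 0 < 2 * `|v| + 1 by have := normr_ge0 v; lra.
have [q qp qv] := h (e / (2 * `|v| + 1)) (divr_gt0 e0 V0).
have -> : dot p v = dot q v - dot (q - p) v by rewrite !dotE; ring.
have h1 : - dot (q - p) v <= 2 * (`|q - p| * `|v|).
  by apply: (le_trans (ler_norm _)); rewrite normrN; exact: ler_dot.
have h2 : `|q - p| * `|v| <= e / (2 * `|v| + 1) * `|v| by rewrite ler_wpM2r// ltW.
have : e / (2 * `|v| + 1) * (2 * `|v| + 1) = e by rewrite divfK ?gt_eqF.
lra.
Qed.

Lemma diff_dot_grad (f : 'rV[R]_2 -> R) z v : differentiable f z ->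
  'd f z v = dot (grad f z) v.
Proof.
move=> df; have -> : v = v 0 0 *: delta_mx ord0 0 + v 0 1 *: delta_mx ord0 1.
  by apply: row2_eq; rewrite !mxE/=; ring.
rewrite linearD !linearZ /= dot2E !mxE/= -!deriveE//.
by rewrite !mulr1 !mulr0 addr0 add0r; congr (_ + _); exact: mulrC.
Qed.

Lemma grad_superdiff u z : differentiable u z -> superdiff u z (grad u z).
Proof.
move=> df; apply/superdiffP => e e0.
have [dl dl0 hdl] := differentiable_estimate _ _ df _ e0.
exists dl => // y /hdl; rewrite -diff_dot_grad//; exact/le_trans/ler_norm.
Qed.

(** A square has positive measure, so it is not contained in a negligible set. *)
Lemma ae_dense (P : 'rV[R]_2 -> Prop) :
  {ae (@lebesgue_measure R \x @lebesgue_measure R)%E, forall z : R * R, P (row2 z)} ->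
  forall x (e : R), 0 < e -> exists2 z, `|z - x| < e & P z.
Proof.
move=> [N [mN N0 sN]] x e e0; apply: contrapT => nP.
pose I i := `[x 0 i, x 0 i + e / 2]%classic.
pose I0 := I 0; pose I1 := I 1.
have sub : I0 `*` I1 `<=` N.
  move=> z [/= z0 z1]; apply: sN => /= Pz; apply: nP; exists (row2 z) => //.
  apply: (@le_lt_trans _ _ (e / 2)); last by lra.
  move: z0 z1; rewrite /I0 /I1 /I /= !in_itv/= => z0 z1.
  by apply: norm_le_coord; rewrite !mxE/= ler_norml; apply/andP; split; lra.
have mI i : measurable (I i) by exact: measurable_itv.
have : ((@lebesgue_measure R \x @lebesgue_measure R) (I0 `*` I1) <= 0)%E.
  rewrite -N0; apply: le_measure => //; rewrite inE//; exact: measurableX (mI _) (mI _).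
have L i : lebesgue_measure (I i) = (e / 2)%:E.
  rewrite /I lebesgue_measure_itv/= lte_fin ifT; last by lra.
  by rewrite -EFinD addrC addKr.
rewrite product_measure1E; [|exact: mI|exact: mI].
rewrite [X in (X * _)%E](L 0) [X in (_ * X)%E](L 1) -EFinM lee_fin leNgt => /negP; apply.
by rewrite mulr_gt0//; lra.
Qed.

End Superdifferential.

(** * The Hamiltonian on superdifferentials *)

Section HamiltonJacobi.
Context {R : realType}.
Implicit Types (x y z p q v w d : 'rV[R]_2) (a b l r t e : R).
Variable H : 'rV[R]_2 -> 'rV[R]_2 -> R -> R.
Hypothesis HC1 : C1 (fun z : ('rV[R]_2 * 'rV[R]_2 * R)%type => H z.1.1 z.1.2 z.2).
Hypothesis Hconvex : forall x r, strictly_convex (fun p => H x p r).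

(** [H] as a function on the normed space on which it is of class C1. *)
Definition uncurried (z : ('rV[R]_2 * 'rV[R]_2 * R)%type) : R := H z.1.1 z.1.2 z.2.

Local Notation F := uncurried.

Lemma derive_momentum x p r v :
  'D_v (fun p => H x p r) p = 'd F (x, p, r) (0, v, 0).
Proof.
rewrite -deriveE; last exact: HC1.1.
rewrite /derive; do 2 f_equal; apply/funext => h /=.
by rewrite /shift/= /uncurried/= !scaler0 !add0r.
Qed.

Lemma dot_grad_momentum x p r v :
  dot (grad (fun p => H x p r) p) v = 'd F (x, p, r) (0, v, 0).
Proof.
rewrite dot2E !mxE !derive_momentum.
have -> : ((0, v, 0) : ('rV[R]_2 * 'rV[R]_2 * R)%type) =
    v 0 0 *: (0, delta_mx ord0 0, 0) + v 0 1 *: (0, delta_mx ord0 1, 0).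
  congr (_, _, _); rewrite /= ?scaler0 ?addr0//.
  by apply: row2_eq; rewrite !mxE/=; ring.
by rewrite linearD !linearZ /=; congr (_ + _); exact: mulrC.
Qed.

Lemma momentum_estimate x p r v e : 0 < e -> exists2 dl : R, 0 < dl &
  forall t, 0 < t < dl ->
  `|H x (p + t *: v) r - H x p r - t * dot (grad (fun p => H x p r) p) v| <= e * t.
Proof.
move=> e0; have e'0 : 0 < e / (`|v| + 1) by rewrite divr_gt0// ltr_wpDl.
have [dl dl0 hdl] := differentiable_estimate F (x, p, r) (HC1.1 _) _ e'0.
have v1 : 0 < `|v| + 1 by rewrite ltr_wpDl.
exists (dl / (`|v| + 1)); first by rewrite divr_gt0.
move=> t /andP[t0]; rewrite ltr_pdivlMr// => tdl.
have E : (x, p + t *: v, r) - (x, p, r) = t *: ((0, v, 0) : ('rV[R]_2 * 'rV[R]_2 * R)%type).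
  by congr (_, _, _); rewrite /= ?scaler0 ?subrr// addrC addKr.
have nv : `|((0, v, 0) : ('rV[R]_2 * 'rV[R]_2 * R)%type)| = `|v|.
  by rewrite !prod_normE/= !normr0 (max_r (normr_ge0 _)) (max_l (normr_ge0 _)).
have nE : `|(x, p + t *: v, r) - (x, p, r)| = t * `|v|.
  by rewrite E normrZ nv ger0_norm// ltW.
have := hdl (x, p + t *: v, r); rewrite nE => /(_ ltac:(lra)).
rewrite E linearZ/= -dot_grad_momentum => /le_trans; apply.
have -> : e / (`|v| + 1) * (t * `|v|) = e * t * (`|v| / (`|v| + 1)) by ring.
by rewrite -[leRHS]mulr1 ler_wpM2l ?mulr_ge0 ?(ltW e0) ?(ltW t0)// ler_pdivrMr// mul1r lerDl.
Qed.

Lemma convex_momentum x r p q l : 0 <= l <= 1 ->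
  H x (l *: p + (1 - l) *: q) r <= l * H x p r + (1 - l) * H x q r.
Proof.
move=> l01; have [->|pq] := eqVneq p q.
  by rewrite -scalerDl -mulrDl !(addrC l) !subrK scale1r mul1r.
have [->|l0] := eqVneq l 0; first by rewrite scale0r add0r subr0 scale1r mul0r mul1r add0r.
have [->|l1] := eqVneq l 1; first by rewrite subrr !scale0r addr0 scale1r mul0r mul1r addr0.
by apply/ltW/Hconvex => //; move: l01; rewrite !le_eqVlt eq_sym (negPf l0) (negPf l1).
Qed.

Lemma convex_gradient_le x r p q :
  H x p r + dot (grad (fun p => H x p r) p) (q - p) <= H x q r.
Proof.
apply/ler_addgt0Pr => e e0.
have [dl dl0 hdl] := momentum_estimate x p r (q - p) _ e0.
pose t := Num.min 1 (dl / 2).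
have t0 : 0 < t by rewrite /t lt_min ltr01 divr_gt0.
have t1 : t <= 1 by rewrite /t ge_min lexx.
have tdl : t < dl by rewrite /t gt_min; apply/orP; right; lra.
have t01 : 0 <= t <= 1 by rewrite ltW.
have := hdl t; rewrite t0 tdl ler_norml => /(_ isT) /andP[h _].
have := convex_momentum x r q p _ t01.
have -> : t *: q + (1 - t) *: p = p + t *: (q - p).
  by apply: row2_eq; rewrite !mxE; ring.
move=> h'; rewrite -(ler_pM2l t0); lra.
Qed.

Variables (Omega : set 'rV[R]_2) (u : 'rV[R]_2 -> R).
Hypothesis usol : viscosity_solution H Omega u.

Lemma u_semiconcave : locally_semiconcave Omega u.
Proof. exact: usol.1. Qed.

Local Notation D := (superdiff u).

Ltac clra := clear -HC1 Hconvex usol; lra.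

Lemma u_near x e : Omega x -> 0 < e -> exists2 dl : R, 0 < dl &
  forall y, `|y - x| < dl -> `|u y - u x| < e.
Proof. by move=> xO; have /continuous_atP := locally_semiconcave_continuous _ _ _ u_semiconcave xO; apply. Qed.

Lemma near_triple (G : ('rV[R]_2 * 'rV[R]_2 * R)%type -> R) x p e : Omega x ->
  {for (x, p, u x), continuous G} -> 0 < e -> exists2 dl : R, 0 < dl &
  forall y q, `|y - x| < dl -> `|q - p| < dl -> `|G (y, q, u y) - G (x, p, u x)| < e.
Proof.
move=> xO /continuous_atP cG e0; have [dl dl0 hdl] := cG _ e0.
have [dl' dl'0 hdl'] := u_near _ _ xO dl0.
exists (Num.min dl dl'); first by rewrite lt_min dl0.
move=> y q; rewrite !lt_min => /andP[y1 y2] /andP[q1 _]; apply: hdl.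
by rewrite !prod_normE/= !gt_max y1 q1 hdl'.
Qed.

Lemma H_near x p e : Omega x -> 0 < e -> exists2 dl : R, 0 < dl &
  forall y q, `|y - x| < dl -> `|q - p| < dl -> `|H y q (u y) - H x p (u x)| < e.
Proof.
move=> xO; apply: (near_triple F) => //.
exact/differentiable_continuous/HC1.1.
Qed.

Lemma Hp_near x p e : Omega x -> 0 < e -> exists2 dl : R, 0 < dl &
  forall y q, `|y - x| < dl -> `|q - p| < dl ->
  `|grad (fun p => H y p (u y)) q - grad (fun p => H x p (u x)) p| < e.
Proof.
move=> xO e0; have c i := HC1.2 ((0, delta_mx ord0 i, 0) : ('rV[R]_2 * 'rV[R]_2 * R)%type).
have e20 : 0 < e / 2 by lra.
have [a a0 ha] := near_triple _ _ _ _ xO (c 0 (x, p, u x)) e20.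
have [b b0 hb] := near_triple _ _ _ _ xO (c 1 (x, p, u x)) e20.
exists (Num.min a b); first by rewrite lt_min a0.
move=> y q; rewrite !lt_min => /andP[y1 y2] /andP[q1 q2].
apply: (@le_lt_trans _ _ (e / 2)); last by lra.
by apply: norm_le_coord; rewrite !mxE !derive_momentum; apply: ltW; [exact: ha|exact: hb].
Qed.

(** These vectors take the place of the limits of gradients: limits of gradients at points
where the equation holds are of this kind, and they suffice to compute the support function
of the superdifferential ([support_reached]). *)
Definition zero_superdiff x := [set q | D x q /\ H x q (u x) = 0].

Lemma zero_superdiff_closed x p : Omega x ->
  (forall e, 0 < e -> exists y q, [/\ `|y - x| < e, `|q - p| < e & zero_superdiff y q]) ->
  zero_superdiff x p.
Proof.
move=> xO hp; split.
  apply: (superdiff_closed _ _ _ _ u_semiconcave xO) => e e0.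
  by have [y [q [yx qp [sq _]]]] := hp e e0; exists y, q.
apply/eqP; rewrite -normr_le0; apply/ler_addgt0Pr => e e0; rewrite add0r.
have [dl dl0 hdl] := H_near x p e xO e0.
have [y [q [yx qp [_ Hq]]]] := hp dl dl0.
by have := hdl y q yx qp; rewrite Hq sub0r normrN => /ltW.
Qed.

(** Move from [x] in the direction [v] and take the gradients at nearby points where the
equation holds: semiconcavity bounds their component along [v] by the slope of [u], and a
cluster point of them is the required element. *)
Lemma slope_reached x v (m c a : R) : Omega x -> 0 < a ->
  (forall t, 0 < t < a -> u (x + t *: v) <= u x + t * m + c * t ^+ 2) ->
  exists2 q, zero_superdiff x q & dot q v <= m.
Proof.
move=> xO a0 hm; have [r [C lb]] := local_boundsP u_semiconcave xO.
case: (lb) => r0 C0 sub lip bd tan.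
have xr : `|x - x| < r by rewrite subrr normr0.
pose V := `|v| + 1; have V0 : 0 < V by rewrite /V ltr_wpDl.
pose K := `|c| + 3 * C + C * V ^+ 2 + 1.
have K0 : 0 < K.
  rewrite /K; have := normr_ge0 c; have := mulr_ge0 (ltW C0) (sqr_ge0 V); lra.
pose A T q := exists z, [/\ `|z - x| < T, zero_superdiff z q & dot q v <= m + T].
have hA T : 0 < T -> exists2 q, `|q| <= C & A T q.
  move=> T0; pose t := Num.min (Num.min (a / 2) 1) (Num.min (r / (V * 2)) (Num.min (T / (V * 2)) (T / K))).
  have V20 : 0 < V * 2 by lra.
  have t0 : 0 < t.
    by rewrite /t !lt_min ltr01 !divr_gt0.
  have ta : t < a by rewrite /t !gt_min; apply/orP; left; apply/orP; left; lra.
  have t1 : t <= 1 by rewrite /t !ge_min lexx ?orbT.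
  have tr : t * V < r.
    have : t <= r / (V * 2) by rewrite /t !ge_min lexx ?orbT.
    by rewrite ler_pdivlMr//; lra.
  have tT : t * V < T.
    have : t <= T / (V * 2) by rewrite /t !ge_min lexx ?orbT.
    by rewrite ler_pdivlMr//; lra.
  have tK : t * K <= T.
    have : t <= T / K by rewrite /t !ge_min lexx ?orbT.
    by rewrite ler_pdivlMr//.
  have t20 : 0 < t ^+ 2 by rewrite exprn_gt0.
  have [z zt Pz] := ae_dense (fun z => Omega z ->
    differentiable u z /\ H z (grad u z) (u z) = 0) usol.2 (x + t *: v) _ t20.
  pose y := x + t *: v.
  have yx : `|y - x| = t * `|v| by rewrite /y addrC addKr normrZ ger0_norm// ltW.
  have zx : `|z - x| <= t * V.
    have -> : z - x = (z - y) + (y - x) by rewrite addrA subrK.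
    apply: (le_trans (ler_normD _ _)); rewrite yx /V mulrDr addrC lerD2l.
    apply: (le_trans (ltW zt)); by rewrite mulr1; nra.
  have yr : `|y - x| < r by rewrite yx; apply: le_lt_trans tr; rewrite /V; have := normr_ge0 v; lra.
  have zr : `|z - x| < r by lra.
  have [dz Hz] := Pz (sub _ zr); set q := grad u z in Hz.
  have sq : D z q := grad_superdiff _ _ dz.
  exists q; first exact: bd _ _ zr sq.
  exists z; split => //; first by lra.
  have hx := tan _ _ _ zr xr sq.
  have hzy := lip _ _ zr yr.
  have hy := hm t; rewrite t0 ta in hy; have {hy} := hy isT; rewrite -/y => hy.
  have hzy' : C * `|z - y| <= C * t ^+ 2 by rewrite ler_wpM2l ?(ltW C0)// ltW.
  have zx2 : C * `|x - z| ^+ 2 <= C * (t * V) ^+ 2.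
    by rewrite ler_wpM2l ?(ltW C0)// ler_pXn2r ?nnegrE// 1?distrC// mulr_ge0// ltW.
  have hc : c * t ^+ 2 <= `|c| * t ^+ 2 by rewrite ler_wpM2r ?ler_norm// ltW.
  have hd : - (2 * (C * t ^+ 2)) <= dot q (z - y).
    rewrite lerNl; apply: (le_trans (ler_norm _)); rewrite normrN.
    apply: (le_trans (ler_dot _ _)); rewrite ler_wpM2l// ler_pM//; last exact: ltW.
    exact: bd _ _ zr sq.
  have dE : dot q (x - z) = - (t * dot q v) - dot q (z - y).
    by rewrite /y !dotE; ring.
  rewrite -(ler_pM2l t0).
  have : t * (t * K) <= t * T by rewrite ler_wpM2l// ltW.
  have -> : t * (t * K) = `|c| * t ^+ 2 + 3 * (C * t ^+ 2) + C * (t * V) ^+ 2 + t ^+ 2.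
    by rewrite /K; ring.
  by rewrite dE in hx; lra.
have [p pC hp] := bounded_cluster _ _ hA.
exists p.
  apply: zero_superdiff_closed => // e e0.
  have [t [q /andP[t0 te] [[z [zt zq _]] qp]]] := hp e e0.
  by exists z, q; split => //; lra.
apply: dot_le_cluster => e e0.
have [t [q /andP[t0 te] [[z [_ _ qv]] qp]]] := hp e e0.
by exists q => //; lra.
Qed.

Lemma tangent_near x p : Omega x -> D x p -> exists C a : R, [/\ 0 < C, 0 < a &
  forall z, `|z - x| < a -> u z <= u x + dot p (z - x) + C * `|z - x| ^+ 2].
Proof.
move=> xO sp; have [r [C [r0 C0 _ _ _ tan]]] := local_boundsP u_semiconcave xO.
by exists C, r; split => // z zr; apply: tan => //; rewrite subrr normr0.
Qed.

(** An element [p] of the superdifferential bounds the slope of [u] in every direction [v] by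
[dot p v]. *)
Lemma support_reached x p v : Omega x -> D x p ->
  exists2 q, zero_superdiff x q & dot q v <= dot p v.
Proof.
move=> xO sp; have [C [a [C0 a0 h]]] := tangent_near _ _ xO sp.
have V0 : 0 < `|v| + 1 by rewrite ltr_wpDl.
apply: (slope_reached x v (dot p v) (C * `|v| ^+ 2) (a / (`|v| + 1))) => //.
  by rewrite divr_gt0.
move=> t /andP[t0]; rewrite ltr_pdivlMr// => ta.
have tv : x + t *: v - x = t *: v by rewrite addrC addKr.
have nt : `|t *: v| = t * `|v| by rewrite normrZ ger0_norm// ltW.
have := h (x + t *: v); rewrite tv nt dotZr => /(_ ltac:(lra)).
by have -> : C * (t * `|v|) ^+ 2 = C * `|v| ^+ 2 * t ^+ 2 by ring.
Qed.

Lemma zero_superdiff_nonempty x : Omega x -> zero_superdiff x !=set0.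
Proof.
move=> xO; have [|q zq _] := slope_reached x 0 0 0 1 xO ltr01; last by exists q.
by move=> t _; rewrite scaler0 !addr0 mulr0 addr0 mul0r addr0.
Qed.

(** If [H] were positive at [p], its gradient at [p] would separate [p] from the zero set
of [H], against [support_reached]. *)
Lemma H_superdiff_le0 x p : Omega x -> D x p -> H x p (u x) <= 0.
Proof.
move=> xO sp; rewrite leNgt; apply/negP => Hp.
set g := grad (fun p => H x p (u x)) p.
have [q [_ Hq] qg] := support_reached x p (- g) xO sp.
have := convex_gradient_le x (u x) p q; rewrite -/g Hq.
by move: qg; rewrite !dotE !(dotC _ g); lra.
Qed.

(** Two distinct elements of the superdifferential have [H <= 0], so [H] is negative at their
midpoint; conversely the superdifferential always contains a zero of [H]. *)
Lemma SigmaP x : Sigma Omega u x <-> Omega x /\ exists2 p, D x p & H x p (u x) < 0.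
Proof.
split=> [[xO ns]|[xO [p sp Hp]]]; split => //; last first.
  move=> [q sq]; have [q' [sq' Hq']] := zero_superdiff_nonempty x xO.
  by move: sp sq'; rewrite sq /= => pq q'q; move: Hp; rewrite pq -q'q Hq' ltxx.
have [p [sp Hp]] := zero_superdiff_nonempty x xO.
have [q [sq qp]] : exists q, D x q /\ q != p.
  apply: contrapT => nq; apply: ns; exists p; apply/seteqP; split => [q sq|q ->//].
  by apply: contrapT => /eqP qp; apply: nq; exists q.
have h : 0 < (2^-1 : R) < 1 by lra.
exists (2^-1 *: q + (1 - 2^-1) *: p).
  have h01 : 0 <= (2^-1 : R) <= 1 by lra.
  exact: superdiff_convex h01 sq sp.
have := Hconvex x (u x) q p _ qp h; rewrite Hp.
have := H_superdiff_le0 x q xO sq ; lra.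
Qed.

Lemma superdiff_compact x : Omega x -> compact (D x).
Proof.
move=> xO; have [r [C [r0 _ _ _ bd _]]] := local_boundsP u_semiconcave xO.
have xr : `|x - x| < r by rewrite subrr normr0.
apply: bounded_closed_compact.
  exists C; split; [exact: num_real | move=> N CN p /= sp].
  exact: le_trans (bd _ _ xr sp) (ltW CN).
move=> p cp /=; apply: (superdiff_closed _ _ _ _ u_semiconcave xO) => e e0.
have [q [sq pq]] := cp _ (nbhsx_ballx p e e0).
exists x, q; split => //; first by rewrite subrr normr0.
by move: pq; rewrite -ball_normE /= distrC.
Qed.

Lemma psharpP x : Omega x -> D x (psharp H u x) /\
  forall q, D x q -> H x (psharp H u x) (u x) <= H x q (u x).
Proof.
move=> xO.
have [p sp hp] : exists2 p, p \in D x & forall q, q \in D x -> H x p (u x) <= H x q (u x).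
  apply: EVT_min_rV (superdiff_compact _ xO) _.
    by have [q [sq _]] := zero_superdiff_nonempty x xO; exists q.
  apply: continuous_subspaceT => p; apply/continuous_atP => e e0.
  have [dl dl0 hdl] := H_near x p e xO e0; exists dl; first exact: dl0.
  by move=> q qp; apply: (hdl x q _ qp); rewrite subrr normr0.
have := @xgetPex _ 0 [set p | D x p /\ forall q, D x q -> H x p (u x) <= H x q (u x)].
rewrite /psharp; apply; exists p; split; first exact: set_mem.
by move=> q sq; apply: hp; exact: mem_set.
Qed.

Lemma psharp_lt0 x : Sigma Omega u x -> H x (psharp H u x) (u x) < 0.
Proof.
move=> /SigmaP[xO [p sp Hp]]; have [_ h] := psharpP x xO.
exact: le_lt_trans (h p sp) Hp.
Qed.

(** First order condition at the minimum of [H x] on a convex set. *)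
Lemma vsharp_optimal x q : Omega x -> D x q ->
  0 <= dot (q - psharp H u x) (vsharp H u x).
Proof.
move=> xO sq; have [sp hp] := psharpP x xO; rewrite dotC.
apply/ler_addgt0Pr => e e0.
have [dl dl0 hdl] := momentum_estimate x (psharp H u x) (u x) (q - psharp H u x) _ e0.
pose t := Num.min 1 (dl / 2).
have t0 : 0 < t by rewrite /t lt_min ltr01 divr_gt0.
have t1 : t <= 1 by rewrite /t ge_min lexx.
have tdl : t < dl by rewrite /t gt_min; apply/orP; right; lra.
have t01 : 0 <= t <= 1 by rewrite ltW.
have := hdl t; rewrite t0 tdl ler_norml => /(_ isT) /andP[_ h].
have := hp _ (superdiff_convex _ _ _ _ _ t01 sq sp).
have -> : t *: q + (1 - t) *: psharp H u x = psharp H u x + t *: (q - psharp H u x).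
  by apply: row2_eq; rewrite !mxE; ring.
by move=> h'; rewrite -(ler_pM2l t0) /vsharp; lra.
Qed.

(** * Superdifferentials in a thin cone *)

Local Notation pt x v w h y := (x + h *: (v + y *: w)).

(** Elements that violate the bound at points tending to [x] would have a cluster point in the
superdifferential at [x]. *)
Lemma superdiff_usc x v (m e : R) : Omega x -> (forall p, D x p -> m <= dot p v) ->
  0 < e -> exists2 dl : R, 0 < dl &
  forall z, `|z - x| < dl -> forall q, D z q -> m - e <= dot q v.
Proof.
move=> xO hm e0; apply: contrapT => nh.
have [r [C [r0 _ _ _ bd _]]] := local_boundsP u_semiconcave xO.
pose A T q := exists z, [/\ `|z - x| < T, D z q & dot q v < m - e].
have hA T : 0 < T -> exists2 q, `|q| <= C & A T q.
  move=> T0; apply: contrapT => nA; apply: nh; exists (Num.min T r).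
    by rewrite lt_min T0.
  move=> z; rewrite lt_min => /andP[zT zr] q sq; rewrite leNgt; apply/negP => qv.
  by apply: nA; exists q; [exact: bd sq | exists z].
have [p _ hp] := bounded_cluster _ _ hA.
have sp : D x p.
  apply: (superdiff_closed _ _ _ _ u_semiconcave xO) => a a0.
  have [t [q /andP[t0 ta] [[z [zt sq _]] qp]]] := hp a a0.
  by exists z, q; split => //; lra.
have : dot p v <= m - e.
  apply: dot_le_cluster => a a0.
  have [t [q _ [[z [_ _ qv]] qp]]] := hp a a0.
  by exists q => //; lra.
have := hm p sp; lra.
Qed.

Lemma pt_norm v w (h y : R) : 0 <= h -> `|y| <= 1 ->
  `|h *: (v + y *: w)| <= h * (`|v| + `|w|).
Proof.
move=> h0 y1; rewrite normrZ ger0_norm// ler_wpM2l//.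
apply: (le_trans (ler_normD _ _)); rewrite lerD2l normrZ.
by rewrite -[leRHS]mul1r ler_wpM2r.
Qed.

(** In a thin cone around a direction [v] in which [p0] is a support point of the
superdifferential at the vertex, all superdifferentials lie in a thin strip around the
supporting line: one side is semicontinuity, the other monotonicity along the ray. *)
Lemma cone_band x p0 v w e : Omega x -> D x p0 ->
  (forall q, D x q -> 0 <= dot (q - p0) v) -> 0 < e ->
  exists2 dl : R, 0 < dl & forall h y : R, 0 < h < dl -> `|y| <= dl ->
    Omega (pt x v w h y) /\
    forall q, D (pt x v w h y) q -> `|dot (q - p0) v| <= e.
Proof.
move=> xO sp0 hv e0; have [r [C [r0 C0 sub lip bd tan]]] := local_boundsP u_semiconcave xO.
have hm p : D x p -> dot p0 v <= dot p v.
  by move=> /hv; rewrite !dotE; lra.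
have [a a0 ha] := superdiff_usc x v _ e xO hm e0.
pose V := `|v| + `|w| + 1.
have V0 : 0 < V by rewrite /V ltr_wpDl// addr_ge0.
pose K := 2 * C * V ^+ 2 + 4 * C * V.
have K0 : 0 < K by rewrite /K addr_gt0// !mulr_gt0// exprn_gt0.
pose dl := Num.min (Num.min 1 (e / K)) (Num.min (a / V) (r / V)).
exists dl; first by rewrite /dl !lt_min ltr01 !divr_gt0.
move=> h y; rewrite {1}/dl !lt_min => /andP[h0 /andP[/andP[h1 he] /andP[hav hr]]].
rewrite {1}/dl !le_min => /andP[/andP[y1 ye] _].
move: he hav hr ye.
rewrite (ltr_pdivlMr _ _ K0) !(ltr_pdivlMr _ _ V0) (ler_pdivlMr _ _ K0) => he hav hr ye.
set z := pt x v w h y.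
have zE : z - x = h *: (v + y *: w) by rewrite /z addrC addKr.
have zx : `|z - x| <= h * V.
  rewrite zE; apply: (le_trans (pt_norm _ _ _ _ (ltW h0) y1)).
  by rewrite ler_wpM2l ?(ltW h0)// /V; lra.
have zr : `|z - x| < r by lra.
have za : `|z - x| < a by lra.
have xr : `|x - x| < r by rewrite subrr normr0.
split; first exact: sub.
move=> q sq; rewrite ler_norml; apply/andP; split.
  by have := ha z za q sq; rewrite !dotE; lra.
have t1 := tan _ _ _ zr xr sq; have t2 := tan _ _ _ xr zr sp0.
have zx2 : C * `|z - x| ^+ 2 <= C * (h * V) ^+ 2.
  by rewrite ler_wpM2l ?(ltW C0)// ler_pXn2r ?nnegrE// mulr_ge0// ltW.
rewrite (distrC x z) in t1.
have hd : dot (q - p0) (z - x) <= 2 * (C * (h * V) ^+ 2).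
  have -> : dot (q - p0) (z - x) = - dot q (x - z) - dot p0 (z - x).
    by rewrite !dotE; ring.
  lra.
have qp0 : `|q - p0| <= 2 * C.
  apply: (le_trans (ler_normB _ _)); have := bd _ _ zr sq; have := bd _ _ xr sp0; lra.
have hw : - (y * dot (q - p0) w) <= `|y| * (4 * C * V).
  apply: (le_trans (ler_norm _)); rewrite normrN normrM ler_wpM2l//.
  apply: (le_trans (ler_dot _ _)).
  have -> : 4 * C * V = 2 * (2 * C * V) by ring.
  rewrite ler_wpM2l// ler_pM// /V; have := normr_ge0 v; lra.
have hy : `|y| * (4 * C * V) + h * (2 * C * V ^+ 2) <= e.
  have hm' : Num.max `|y| h * K <= e by rewrite maxEle; case: ifP => _; lra.
  set M := Num.max _ _ in hm'; apply: le_trans hm'.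
  have -> : M * K = M * (4 * C * V) + M * (2 * C * V ^+ 2) by rewrite /K; ring.
  rewrite /M; apply: lerD.
    by rewrite ler_wpM2r ?le_max ?lexx ?orbT// !mulr_ge0 ?exprn_ge0// ltW.
  by rewrite ler_wpM2r ?le_max ?lexx ?orbT// !mulr_ge0// ltW.
rewrite -(ler_pM2l h0); move: hd; rewrite zE dotZr dotDr dotZr.
have := ler_wpM2l (ltW h0) hw; have := ler_wpM2l (ltW h0) hy.
have -> : (h * V) ^+ 2 = h * (h * V ^+ 2) by ring.
lra.
Qed.

Section Vertex.
Variables (x w : 'rV[R]_2).
Hypothesis xS : Sigma Omega u x.
Let v := vsharp H u x.
Let p0 := psharp H u x.
Hypothesis vw : dot (rot v) w != 0.

Let xO : Omega x := xS.1.
Let sp0 : D x p0 := (psharpP x xO).1.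
Let p0_opt q : D x q -> 0 <= dot (q - p0) v := vsharp_optimal x q xO.

Lemma independent_eq0 d : dot d v = 0 -> dot d w = 0 -> d = 0.
Proof.
move=> dv dw; have [K K0 hK] := dot_pair_bound _ _ vw.
apply/eqP; rewrite -normr_le0; apply: (le_trans (hK d)).
by rewrite dv dw normr0 addr0 mulr0.
Qed.

(** The face of the superdifferential orthogonal to [v] extends beyond [p0] in the
direction [w]: tilt [v] slightly away from [w]; the zeros of [H] reached in the tilted
directions tend to a zero of [H] on the face, which is not [p0] as [H] is negative there. *)
Lemma face_reached : exists q, [/\ D x q, dot (q - p0) v = 0 & 0 < dot (q - p0) w].
Proof.
have [r [C [r0 C0 _ _ bd _]]] := local_boundsP u_semiconcave xO.
have xr : `|x - x| < r by rewrite subrr normr0.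
pose V := `|w| + 1; have V0 : 0 < V by rewrite /V ltr_wpDl.
have CV : 0 < 4 * C * V by rewrite !mulr_gt0.
pose A T q := [/\ zero_superdiff x q, dot (q - p0) v <= T & 0 <= dot (q - p0) w].
have hA T : 0 < T -> exists2 q, `|q| <= C & A T q.
  move=> T0; pose e := T / (4 * C * V); have e0 : 0 < e by rewrite divr_gt0.
  have [q [sq Hq] qv] := support_reached x p0 (v - e *: w) xO sp0.
  exists q; first exact: bd xr sq.
  have h : dot (q - p0) v <= e * dot (q - p0) w.
    by move: qv; rewrite !dotE; lra.
  have hw : dot (q - p0) w <= 4 * C * V.
    apply: (le_trans (ler_norm _)); apply: (le_trans (ler_dot _ _)).
    have -> : 4 * C * V = 2 * (2 * C * V) by ring.
    rewrite ler_wpM2l// ler_pM// /V; last by lra.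
    apply: (le_trans (ler_normB _ _)); have := bd _ _ xr sq; have := bd _ _ xr sp0; lra.
  split => //.
    apply: (le_trans h); have -> : T = e * (4 * C * V) by rewrite /e divfK ?gt_eqF.
    by rewrite ler_wpM2l// ltW.
  by rewrite -(pmulr_rge0 _ e0); have := p0_opt _ sq; lra.
have [q _ hq] := bounded_cluster _ _ hA.
have [sq Hq] : zero_superdiff x q.
  apply: zero_superdiff_closed => // e e0.
  have [t [q' _ [[zq _ _] qq]]] := hq e e0.
  by exists x, q'; rewrite subrr normr0.
have qv : dot (q - p0) v <= 0.
  suff : dot q v <= dot p0 v by rewrite !dotE; lra.
  apply: dot_le_cluster => e e0; have [t [q' /andP[t0 te] [[_ h _] qq]]] := hq e e0.
  by exists q' => //; move: h; rewrite !dotE; lra.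
have qw : 0 <= dot (q - p0) w.
  suff : dot q (- w) <= dot p0 (- w) by rewrite !dotE; lra.
  apply: dot_le_cluster => e e0; have [t [q' /andP[t0 te] [[_ _ h] qq]]] := hq e e0.
  by exists q' => //; move: h; rewrite !dotE; lra.
have qv0 : dot (q - p0) v = 0 by apply/le_anti; rewrite qv p0_opt.
exists q; split => //; rewrite lt_neqAle qw andbT eq_sym; apply/eqP => qw0.
have := independent_eq0 _ qv0 qw0; move/subr0_eq => qp.
by have := psharp_lt0 x xS; rewrite -/p0 -qp Hq ltxx.
Qed.

End Vertex.

(** On a short segment transversal to [v] across the cone, [u] minus the linear form [p0]
is smaller at both ends than in the middle, because of the two ends of the face. At an
interior maximum, the slopes in the two opposite directions produce elements of the
superdifferential on either side of [p0]. *)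
Lemma crossing_exists x w e (v := vsharp H u x) (p0 := psharp H u x) :
  Sigma Omega u x -> dot (rot v) w != 0 -> 0 < e ->
  exists2 dl : R, 0 < dl & forall h : R, 0 < h < dl -> exists2 y : R, `|y| <= e &
    exists2 p, D (pt x v w h y) p & dot (p - p0) w = 0.
Proof.
move=> xS vw; have xO : Omega x := xS.1.
have sp0 : D x p0 := (psharpP x xO).1.
have p0_opt q : D x q -> 0 <= dot (q - p0) v := vsharp_optimal x q xO.
wlog e1 : e / e <= 1.
  move=> gen e0; have [||dl dl0 hdl] := gen (Num.min e 1).
  - by rewrite ge_min lexx orbT.
  - by rewrite lt_min e0 ltr01.
  by exists dl => // h /hdl [y ye hy]; exists y => //; apply: le_trans ye _; rewrite ge_min lexx.
move=> e0.
have vwN : dot (rot v) (- w) != 0 by rewrite dotNr oppr_eq0.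
have [p1 [sp1 p1v p1w]] := face_reached x w xS vw.
have [p2 [sp2 p2v p2w]] := face_reached x (- w) xS vwN.
rewrite -/v -/p0 in p1v p1w p2v p2w.
have [r [C [r0 C0 sub lip bd tan]]] := local_boundsP u_semiconcave xO.
pose k := Num.min (dot (p1 - p0) w) (dot (p2 - p0) (- w)).
have k0 : 0 < k by rewrite /k lt_min p1w.
have k1 : k <= dot (p1 - p0) w by rewrite /k ge_min lexx.
have k2 : k <= - dot (p2 - p0) w by rewrite -dotNr /k ge_min lexx orbT.
have ek : 0 < e * k / 4 by rewrite !mulr_gt0.
have [a a0 ha] := cone_band x p0 v w _ xO sp0 p0_opt ek.
pose V := `|v| + `|w| + 1.
have V0 : 0 < V by rewrite /V ltr_wpDl// addr_ge0.
have CV : 0 < 4 * C * V ^+ 2 by rewrite !mulr_gt0// exprn_gt0.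
exists (Num.min a (Num.min (r / V) (e * k / (4 * C * V ^+ 2)))).
  by rewrite !lt_min a0 !divr_gt0// mulr_gt0.
move=> h; rewrite !lt_min => /andP[h0 /andP[hea /andP[]]].
rewrite !ltr_pdivlMr// => hr hk.
have ptE (y : R) : pt x v w h y - x = h *: (v + y *: w) by rewrite addrC addKr.
have ptn (y : R) : `|y| <= 1 -> `|pt x v w h y - x| <= h * V.
  move=> y1; rewrite ptE; apply: (le_trans (pt_norm _ _ _ _ (ltW h0) y1)).
  by rewrite ler_wpM2l ?(ltW h0)// /V; lra.
have ptr (y : R) : `|y| <= 1 -> `|pt x v w h y - x| < r.
  by move=> /ptn ?; lra.
have ptr2 (y : R) : `|y| <= 1 -> C * `|pt x v w h y - x| ^+ 2 <= h * (C * h * V ^+ 2).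
  move=> /ptn hy; have -> : h * (C * h * V ^+ 2) = C * (h * V) ^+ 2 by ring.
  by rewrite ler_wpM2l ?(ltW C0)// ler_pXn2r ?nnegrE// mulr_ge0// ltW.
have xr : `|x - x| < r by rewrite subrr normr0.
pose f (y : R) := u (pt x v w h y) - h * (y * dot p0 w).
have fcont : {within `[- e, e], continuous f}%classic.
  apply: continuous_in_subspaceT => y; rewrite inE/= in_itv/= => ye.
  have y1 : `|y| <= 1 by rewrite ler_norml; lra.
  apply: cvgB; last first.
    by apply: cvgM; [exact: cvg_cst|apply: cvgM; [exact: cvg_id|exact: cvg_cst]].
  apply: continuous_comp; last first.
    exact/(locally_semiconcave_continuous _ _ _ u_semiconcave)/sub/ptr.
  apply: cvgD; first exact: cvg_cst.
  apply: cvgZ; first exact: cvg_cst.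
  apply: cvgD; first exact: cvg_cst.
  by apply: cvgZ; [exact: cvg_id|exact: cvg_cst].
have eNe : - e <= e by move: e0; clra.
have [c ce fc] := EVT_max eNe fcont.
have f0 : u x + h * dot p0 v - h * (e * k / 2) < f 0.
  have y0 : `|0 : R| <= 1 by rewrite normr0.
  have y0a : `|0 : R| <= a by rewrite normr0 ltW.
  have h0a : 0 < h < a by rewrite h0.
  have [zO hz] := ha h 0 h0a y0a.
  have [q [sq _]] := zero_superdiff_nonempty _ zO.
  have := hz q sq; rewrite ler_norml => /andP[qv _].
  have := tan _ _ _ (ptr 0 y0) xr sq.
  have -> : x - pt x v w h 0 = - (h *: v).
    by rewrite scale0r addr0 opprD addrA subrr add0r.
  have := ptr2 _ y0; rewrite /f mul0r mulr0 subr0 (_ : pt x v w h 0 - x = h *: v); last first.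
    by rewrite ptE scale0r addr0.
  rewrite normrN dotNr dotZr => t1 t2.
  have := ler_wpM2l (ltW h0) qv; rewrite !dotE => t3.
  have : h * (C * h * V ^+ 2) < h * (e * k / 4) by rewrite ltr_pM2l//; move: hk; clra.
  by move: t1 t2 t3; clra.
have fend (y : R) q : `|y| = e -> D x q -> dot (q - p0) v = 0 -> y * dot (q - p0) w <= - (e * k) ->
    f y < f 0.
  move=> ye sq qv qw; apply: le_lt_trans f0.
  have y1 : `|y| <= 1 by rewrite ye.
  have := tan _ _ _ xr (ptr y y1) sq; rewrite {1}ptE dotZr dotDr dotZr => t1.
  have t2 := ptr2 _ y1.
  have : h * (C * h * V ^+ 2) <= h * (e * k / 4) by rewrite ler_pM2l//; move: hk; clra.
  have := ler_wpM2l (ltW h0) qw; rewrite /f; move: qv; rewrite !dotE => qv t3 t4.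
  have -> : dot p0 v = dot q v by move: qv; clra.
  have : 0 < h * (e * k) by rewrite !mulr_gt0.
  by move: t1 t2 t3 t4; clra.
have fe : f e < f 0.
  apply: (fend e p2) => //; first by rewrite ger0_norm// ltW.
  by rewrite -mulrN ler_pM2l//; move: k2; rewrite !dotE; clra.
have fNe : f (- e) < f 0.
  apply: (fend (- e) p1) => //; first by rewrite normrN ger0_norm// ltW.
  by rewrite mulNr lerN2 ler_pM2l.
have f0c : f 0 <= f c by apply: fc; rewrite in_itv/=; move: e0; clra.
have [cN cP] : - e < c /\ c < e.
  move: ce; rewrite in_itv/= => /andP[c1 c2]; split; rewrite lt_neqAle ?c1 ?c2 andbT.
    by apply/eqP => cE; move: fNe; rewrite cE ltNge f0c.
  by apply/eqP => cE; move: fe; rewrite -cE ltNge f0c.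
have cn : `|c| <= e by rewrite ler_norml !ltW.
exists c => //.
set z := pt x v w h c.
have zO : Omega z by apply/sub/ptr/(le_trans cn).
have slope (s : R) : s = 1 \/ s = -1 -> exists2 q, D z q & dot q (s *: w) <= dot p0 (s *: w).
  move=> s1; have hs : 0 < h * Num.min (e - c) (e + c).
    by rewrite mulr_gt0// lt_min; move: cN cP; clra.
  have [t|q [sq _] qs] := slope_reached z (s *: w) (dot p0 (s *: w)) 0 _ zO hs; last by exists q.
  move=> /andP[t0]; rewrite -ltr_pdivrMl// lt_min => /andP[t1 t2].
  have -> : z + t *: (s *: w) = pt x v w h (c + h^-1 * t * s).
    by apply: row2_eq; rewrite /z !mxE; field; rewrite gt_eqF.
  have := fc (c + h^-1 * t * s).
  have ht0 : 0 < h^-1 * t by rewrite mulr_gt0// invr_gt0.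
  have -> : c + h^-1 * t * s \in `[- e, e] by rewrite in_itv/=; case: s1 => ->;
      move: ht0 t1 t2 cN cP; clra.
  move=> /(_ isT); rewrite /f -/z dotZr mul0r addr0.
  have -> : h * ((c + h^-1 * t * s) * dot p0 w) = h * (c * dot p0 w) + t * (s * dot p0 w).
    by field; rewrite gt_eqF.
  by clra.
have [q1 sq1 q1w] := slope 1 (or_introl erefl).
have [q2 sq2 q2w] := slope (-1) (or_intror erefl).
move: q1w q2w; rewrite !dotE !mul1r !mulN1r lerN2 => q1w q2w.
have q12 : dot q1 w <= dot p0 w <= dot q2 w by rewrite q1w.
have [p sp pw] := superdiff_intermediate _ _ _ _ _ _ sq1 sq2 q12.
by exists p; rewrite // !dotE pw subrr.
Qed.

(** Strict convexity makes [p0] the strict minimum of [H x] along the line through it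
orthogonal to [v], while the superdifferentials in the cone are close to that line. *)
Lemma psharp_near x w e (v := vsharp H u x) (p0 := psharp H u x) :
  Sigma Omega u x -> dot (rot v) w != 0 -> 0 < e ->
  exists2 dl : R, 0 < dl & forall h y : R, 0 < h < dl -> `|y| <= dl ->
    forall p, D (pt x v w h y) p -> dot (p - p0) w = 0 ->
    `|psharp H u (pt x v w h y) - p0| < e.
Proof.
move=> xS vw; have xO : Omega x := xS.1.
have sp0 : D x p0 := (psharpP x xO).1.
have p0_opt q : D x q -> 0 <= dot (q - p0) v := vsharp_optimal x q xO.
have p0_min q : H x p0 (u x) + dot v (q - p0) <= H x q (u x) := convex_gradient_le x (u x) p0 q.
clearbody v p0.
move=> e0; have [K K0 hK] := dot_pair_bound _ _ vw.
pose b := e / (4 * K); have b0 : 0 < b by rewrite divr_gt0// mulr_gt0.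
have [d dv dw] : exists2 d, dot d v = 0 & dot d w = b.
  by exists ((b / dot (rot v) w) *: rot v); rewrite dotZl ?dot_rot ?mulr0// divfK.
have d0 : d != 0 by apply: contraTneq b0 => dE; rewrite -dw dE dot0l ltxx.
have Hd s : s = 1 \/ s = -1 -> H x p0 (u x) < H x (p0 + s *: d) (u x).
  move=> hs; have sd : p0 + s *: d != p0.
    rewrite -subr_eq0 addrC addKr scaler_eq0 negb_or d0 andbT.
    by case: hs => ->; rewrite ?oppr_eq0 oner_eq0.
  have h01 : 0 < (2^-1 : R) < 1 by lra.
  have := Hconvex x (u x) _ _ _ sd h01.
  have := p0_min (2^-1 *: (p0 + s *: d) + (1 - 2^-1) *: p0).
  have -> : 2^-1 *: (p0 + s *: d) + (1 - 2^-1) *: p0 - p0 = (2^-1 * s) *: d.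
    by apply: row2_eq; rewrite !mxE; field.
  rewrite dotZr dotC dv mulr0 addr0; lra.
pose mu := Num.min (H x (p0 + 1 *: d) (u x) - H x p0 (u x))
                   (H x (p0 + -1 *: d) (u x) - H x p0 (u x)).
have mu0 : 0 < mu / 2.
  by rewrite divr_gt0// lt_min !subr_gt0 !Hd//; [right|left].
have mus s : s = 1 \/ s = -1 -> mu <= H x (p0 + s *: d) (u x) - H x p0 (u x).
  by case=> ->; rewrite /mu ge_min lexx ?orbT.
have [d1 d10 h1] := H_near x p0 _ xO mu0.
have [d2 d20 h2] := H_near x (p0 + 1 *: d) _ xO mu0.
have [d3 d30 h3] := H_near x (p0 + -1 *: d) _ xO mu0.
pose m := Num.min d1 (Num.min d2 d3).
have m0 : 0 < m by rewrite !lt_min d10 d20.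
pose eta := Num.min (e / (4 * K)) (m / (2 * K)).
have eta0 : 0 < eta by rewrite lt_min !divr_gt0// mulr_gt0.
have etaK : K * eta <= e / 4.
  have : eta <= e / (4 * K) by rewrite /eta ge_min lexx.
  by rewrite ler_pdivlMr ?mulr_gt0//; lra.
have etam : K * eta < m.
  have : eta <= m / (2 * K) by rewrite /eta ge_min lexx orbT.
  by rewrite ler_pdivlMr ?mulr_gt0//; lra.
have [a a0 ha] := cone_band x p0 v w _ xO sp0 p0_opt eta0.
pose V := `|v| + `|w| + 1.
have V0 : 0 < V by rewrite /V ltr_wpDl// addr_ge0.
exists (Num.min (Num.min a 1) (m / V)); first by rewrite !lt_min a0 ltr01 divr_gt0.
move=> h y; rewrite !lt_min !le_min (ltr_pdivlMr _ _ V0).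
move=> /andP[h0 /andP[/andP[hea _] hm]] /andP[/andP[ya y1] _].
have h0a : 0 < h < a by rewrite h0.
have [zO hz] := ha h y h0a ya.
set z := pt x v w h y in zO hz *.
have zx : `|z - x| < m.
  apply: le_lt_trans hm; rewrite /z addrC addKr.
  apply: (le_trans (pt_norm _ _ _ _ (ltW h0) y1)).
  by rewrite ler_wpM2l ?(ltW h0)// /V; lra.
move: (zx); rewrite !lt_min => /and3P[zd1 zd2 zd3].
move=> p sp pw; have := psharpP z zO; move: (psharp H u z) => q [sq hq].
have pv := hz p sp; have qv := hz q sq.
have pn : `|p - p0| < m.
  by apply: (le_lt_trans (hK _)); rewrite pw normr0 addr0; apply: le_lt_trans etam; rewrite ler_pM2l.
move: (pn); rewrite !lt_min => /and3P[pd1 _ _].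
have Hp : H z p (u z) < H x p0 (u x) + mu / 2.
  by move: (h1 z p zd1 pd1); rewrite ltr_norml; clra.
have Hqp := hq p sp.
(* Otherwise the segment from p to the minimizer meets the line through p0 + d or p0 - d
   parallel to v, where H is too large. *)
have far s : s = 1 \/ s = -1 -> b <= s * dot (q - p0) w -> False.
  move=> hs hb; pose be := s * dot (q - p0) w; have be0 : 0 < be by exact: lt_le_trans hb.
  pose l := b / be.
  have l01 : 0 <= l <= 1.
    by rewrite /l divr_ge0 ?(ltW b0) ?(ltW be0)//= ler_pdivrMr// mul1r.
  pose n := l *: q + (1 - l) *: p.
  have ss : s * s = 1 by case: hs => ->; ring.
  have nw : dot (n - (p0 + s *: d)) w = 0.
    have -> : dot (n - (p0 + s *: d)) w =
        l * dot (q - p0) w + (1 - l) * dot (p - p0) w - s * dot d w.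
      by rewrite /n !dotE; ring.
    rewrite pw mulr0 addr0 dw.
    have -> : dot (q - p0) w = s * be by rewrite /be mulrA ss mul1r.
    by rewrite /l mulrCA divfK ?gt_eqF// subrr.
  have nv : `|dot (n - (p0 + s *: d)) v| <= eta.
    have -> : dot (n - (p0 + s *: d)) v =
        l * dot (q - p0) v + (1 - l) * dot (p - p0) v - s * dot d v.
      by rewrite /n !dotE; ring.
    by rewrite dv mulr0 subr0; exact: convex_comb_norm.
  have nn : `|n - (p0 + s *: d)| < m.
    by apply: (le_lt_trans (hK _)); rewrite nw normr0 addr0; apply: le_lt_trans etam; rewrite ler_pM2l.
  move: (nn); rewrite !lt_min => /and3P[_ nd2 nd3].
  have Hn : `|H z n (u z) - H x (p0 + s *: d) (u x)| < mu / 2.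
    by case: hs nd2 nd3 => -> nd2 nd3; [exact: h2|exact: h3].
  have := convex_momentum z (u z) q p _ l01; rewrite -/n.
  have := mus s hs; move: Hn; rewrite ltr_norml.
  have l0 : 0 <= l by case/andP: l01.
  by move: Hp (ler_wpM2l l0 Hqp); clra.
have qw : `|dot (q - p0) w| <= b.
  rewrite ler_norml; apply/andP; split; rewrite leNgt; apply/negP => hb.
    by apply: (far (-1)); [right|rewrite mulN1r lerNr ltW].
  by apply: (far 1); [left|rewrite mul1r ltW].
apply: (le_lt_trans (hK _)).
have : K * b = e / 4 by rewrite /b; field; rewrite gt_eqF.
have := ler_wpM2l (ltW K0) qw; have := ler_wpM2l (ltW K0) qv.
by rewrite mulrDr; move: etaK e0; clra.
Qed.

Lemma pt_near x v w e : 0 < e -> exists2 dl : R, 0 < dl &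
  forall h y : R, 0 < h < dl -> `|y| <= dl -> `|pt x v w h y - x| < e.
Proof.
move=> e0; pose V := `|v| + `|w| + 1.
have V0 : 0 < V by rewrite /V ltr_wpDl// addr_ge0.
exists (Num.min 1 (e / V)); first by rewrite lt_min ltr01 divr_gt0.
move=> h y; rewrite !lt_min !le_min ltr_pdivlMr//.
move=> /andP[h0 /andP[_ hV]] /andP[y1 _]; rewrite addrC addKr.
apply: (le_lt_trans (pt_norm _ _ _ _ (ltW h0) y1)); apply: le_lt_trans hV.
by rewrite ler_wpM2l ?(ltW h0)// /V; lra.
Qed.

Lemma sharp_near x w e (v := vsharp H u x) (p0 := psharp H u x) :
  Sigma Omega u x -> dot (rot v) w != 0 -> 0 < e ->
  exists2 dl : R, 0 < dl & forall h y : R, 0 < h < dl -> `|y| <= dl ->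
    forall p, D (pt x v w h y) p -> dot (p - p0) w = 0 ->
    `|psharp H u (pt x v w h y) - p0| < e /\ `|vsharp H u (pt x v w h y) - v| < e.
Proof.
move=> xS vw e0.
have [a a0 ha] := Hp_near x p0 e xS.1 e0.
have ea0 : 0 < Num.min e a by rewrite lt_min e0.
have [b b0 hb] := psharp_near x w _ xS vw ea0.
have [c c0 hc] := pt_near x v w _ a0.
exists (Num.min b c); first by rewrite lt_min b0.
move=> h y; rewrite !lt_min !le_min => /andP[h0 /andP[h1 h2]] /andP[y1 y2] p sp pw.
have h0b : 0 < h < b by rewrite h0.
have h0c : 0 < h < c by rewrite h0.
have := hb h y h0b y1 p sp pw; rewrite lt_min => /andP[q1 q2]; split => //.
by apply: ha => //; exact: hc.
Qed.

(** Near [p0], [H] is negative, so the zeros of [H] in a superdifferential in the cone stay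
away from [p0]: they form two groups, one on each side of [p0] along [w]. A superdifferential
that comes near [p0] thus contains elements of both groups. *)
Lemma crossing_gap x w (v := vsharp H u x) (p0 := psharp H u x) :
  Sigma Omega u x -> dot (rot v) w != 0 ->
  exists k dl : R, [/\ 0 < k, 0 < dl & forall h y : R, 0 < h < dl -> `|y| <= dl ->
    forall p, D (pt x v w h y) p -> `|dot (p - p0) w| < k ->
    [/\ Sigma Omega u (pt x v w h y),
        exists2 q, D (pt x v w h y) q & k <= dot (q - p0) w &
        exists2 q, D (pt x v w h y) q & dot (q - p0) w <= - k]].
Proof.
move=> xS vw; have xO : Omega x := xS.1.
have sp0 : D x p0 := (psharpP x xO).1.
have p0_opt q : D x q -> 0 <= dot (q - p0) v := vsharp_optimal x q xO.
have [K K0 hK] := dot_pair_bound _ _ vw.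
have Hp0 : 0 < - H x p0 (u x) by rewrite oppr_gt0; exact: psharp_lt0.
have [a a0 ha] := H_near x p0 _ xO Hp0.
pose k := a / (2 * K); have k0 : 0 < k by rewrite divr_gt0// mulr_gt0.
have [b b0 hb] := cone_band x p0 v w _ xO sp0 p0_opt k0.
have [c c0 hc] := pt_near x v w _ a0.
exists k, (Num.min b c); split; [exact: k0|by rewrite lt_min b0|].
move=> h y; rewrite !lt_min !le_min => /andP[h0 /andP[h1 h2]] /andP[y1 y2].
have h0b : 0 < h < b by rewrite h0.
have h0c : 0 < h < c by rewrite h0.
have [zO band] := hb h y h0b y1; have zx := hc h y h0c y2.
set z := pt x v w h y in zO band zx *.
have neg q : D z q -> `|dot (q - p0) w| < k -> H z q (u z) < 0.
  move=> sq qw; have qv := band q sq.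
  have qa : `|q - p0| < a.
    apply: (le_lt_trans (hK _)).
    have -> : a = K * (k + k) by rewrite /k; field; rewrite gt_eqF.
    by rewrite ltr_pM2l// ler_ltD.
  by move: (ha z q zx qa); rewrite ltr_norml; clra.
have far q : D z q -> H z q (u z) = 0 -> k <= `|dot (q - p0) w|.
  by move=> sq Hq; rewrite leNgt; apply/negP => /(neg q sq); rewrite Hq ltxx.
move=> p sp pw; split.
- by apply/SigmaP; split => //; exists p => //; exact: neg.
- have [q [sq Hq] qw] := support_reached z p (- w) zO sp.
  exists q => //; have := far q sq Hq.
  move: qw pw; rewrite ltr_norml !dotE lerN2 => qw /andP[pw1 _].
  by rewrite ler_normr => /orP[|]; move: qw pw1; clra.
- have [q [sq Hq] qw] := support_reached z p w zO sp.
  exists q => //; have := far q sq Hq.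
  move: qw pw; rewrite ltr_norml !dotE => qw /andP[_ pw1].
  by rewrite ler_normr => /orP[|]; move: qw pw1; clra.
Qed.

(** At two points of the cone whose superdifferentials come near [p0], compare an element on
one side of [p0] at the first point with one on the other side at the second: monotonicity of
the superdifferential (up to a quadratic term) bounds the transversal distance by the
longitudinal one. *)
Lemma crossing_lipschitz x w (v := vsharp H u x) (p0 := psharp H u x) :
  Sigma Omega u x -> dot (rot v) w != 0 ->
  exists k dl : R, [/\ 0 < k, 0 < dl,
    forall h y : R, 0 < h < dl -> `|y| <= dl ->
      forall p, D (pt x v w h y) p -> `|dot (p - p0) w| < k ->
      Sigma Omega u (pt x v w h y) &
    forall h y h' y' : R, 0 < h < dl -> `|y| <= dl -> 0 < h' < dl -> `|y'| <= dl ->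
      forall p p', D (pt x v w h y) p -> `|dot (p - p0) w| < k ->
      D (pt x v w h' y') p' -> `|dot (p' - p0) w| < k ->
      `|h * y - h' * y'| <= `|h - h'|].
Proof.
move=> xS vw; have xO : Omega x := xS.1.
have sp0 : D x p0 := (psharpP x xO).1.
have p0_opt q : D x q -> 0 <= dot (q - p0) v := vsharp_optimal x q xO.
have [k [dg [k0 dg0 gap]]] := crossing_gap x w xS vw.
rewrite -/v -/p0 in gap; clearbody v p0.
have [r [C [r0 C0 sub lip bd tan]]] := local_boundsP u_semiconcave xO.
have k40 : 0 < k / 4 by rewrite divr_gt0.
have [b b0 band] := cone_band x p0 v w _ xO sp0 p0_opt k40.
pose V := `|v| + `|w| + 1.
have V0 : 0 < V by rewrite /V ltr_wpDl// addr_ge0.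
pose m := Num.min r (k / (8 * C * V)).
have m0 : 0 < m by rewrite lt_min r0 divr_gt0// !mulr_gt0.
have [c c0 near] := pt_near x v w _ m0.
exists k, (Num.min dg (Num.min b c)).
have hmin (h y : R) : 0 < h < Num.min dg (Num.min b c) -> `|y| <= Num.min dg (Num.min b c) ->
    [/\ 0 < h < dg, 0 < h < b & 0 < h < c] /\ [/\ `|y| <= dg, `|y| <= b & `|y| <= c].
  by rewrite !lt_min !le_min => /andP[-> /andP[-> /andP[-> ->]]] /andP[-> /andP[-> ->]].
split; [exact: k0|by rewrite !lt_min dg0 b0| |].
  by move=> h y /hmin h' /h' [[h1 _ _] [y1 _ _]] p sp pw; have [] := gap h y h1 y1 p sp pw.
have mono (h y h' y' : R) : 0 < h < Num.min dg (Num.min b c) ->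
    `|y| <= Num.min dg (Num.min b c) -> 0 < h' < Num.min dg (Num.min b c) ->
    `|y'| <= Num.min dg (Num.min b c) ->
    forall p p', D (pt x v w h y) p -> `|dot (p - p0) w| < k ->
    D (pt x v w h' y') p' -> `|dot (p' - p0) w| < k ->
    h * y - h' * y' <= `|h - h'|.
  move=> /hmin hh /hh [[h1 h2 h3] [y1 y2 y3]] /hmin hh' /hh' [[h1' h2' h3'] [y1' y2' y3']].
  move=> p p' sp pw sp' pw'.
  have [_ [q sq qw] _] := gap h y h1 y1 p sp pw.
  have [_ _ [q' sq' qw']] := gap h' y' h1' y1' p' sp' pw'.
  have [_ /(_ q sq) qv] := band h y h2 y2.
  have [_ /(_ q' sq') qv'] := band h' y' h2' y2'.
  have zx := near h y h3 y3; have zx' := near h' y' h3' y3'.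
  set z := pt x v w h y in sp sq zx *; set z' := pt x v w h' y' in sp' sq' zx' *.
  move: (zx) (zx'); rewrite !lt_min => /andP[zr zm] /andP[zr' zm'].
  have t1 := tan _ _ _ zr zr' sq; have t2 := tan _ _ _ zr' zr sq'.
  rewrite (distrC z' z) in t1.
  set dh := h - h'; set dy := h * y - h' * y'.
  have zz : z - z' = dh *: v + dy *: w.
    by apply: row2_eq; rewrite /z /z' /dh /dy !mxE; ring.
  have zzn : `|z - z'| <= V * (`|dh| + `|dy|).
    rewrite zz; apply: (le_trans (ler_normD _ _)); rewrite !normrZ /V.
    have := mulr_ge0 (normr_ge0 dh) (normr_ge0 w); have := mulr_ge0 (normr_ge0 dy) (normr_ge0 v).
    have := normr_ge0 dh; have := normr_ge0 dy; clra.
  have zzm : `|z - z'| * (8 * C * V) <= 2 * k.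
    have : `|z - z'| <= 2 * (k / (8 * C * V)).
      have -> : z - z' = (z - x) - (z' - x) by rewrite opprB addrA subrK.
      by apply: (le_trans (ler_normB _ _)); move: zm zm'; clra.
    by rewrite mulrA ler_pdivlMr ?mulr_gt0.
  have quad : 2 * C * `|z - z'| ^+ 2 <= k / 2 * (`|dh| + `|dy|).
    have n0 := normr_ge0 (z - z').
    have C20 : 0 <= 2 * C * `|z - z'| by rewrite !mulr_ge0// ltW.
    have := ler_wpM2l C20 zzn.
    have -> : 2 * C * `|z - z'| * `|z - z'| = 2 * C * `|z - z'| ^+ 2 by ring.
    move/le_trans; apply.
    have -> : 2 * C * `|z - z'| * (V * (`|dh| + `|dy|)) =
      `|z - z'| * (8 * C * V) / 4 * (`|dh| + `|dy|) by field.
    by apply: ler_wpM2r; [rewrite addr_ge0|move: zzm; clra].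
  have key : dot (q - q') (z - z') <= 2 * C * `|z - z'| ^+ 2.
    have -> : dot (q - q') (z - z') = - dot q (z' - z) - dot q' (z - z').
      by rewrite !dotE; ring.
    by move: t1 t2; clra.
  have key2 : dh * dot (q - q') v + dy * dot (q - q') w <= k / 2 * (`|dh| + `|dy|).
    by apply: le_trans quad; move: key; rewrite {1}zz dotDr !dotZr.
  have qq : `|dot (q - q') v| <= k / 2.
    have -> : dot (q - q') v = dot (q - p0) v - dot (q' - p0) v by rewrite !dotE; ring.
    by apply: (le_trans (ler_normB _ _)); move: qv qv'; clra.
  have key3 : - (`|dh| * (k / 2)) <= dh * dot (q - q') v.
    rewrite lerNl; apply: (le_trans (ler_norm _)); rewrite normrN normrM.
    by rewrite ler_wpM2l.
  have qqw : 2 * k <= dot (q - q') w.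
    by move: qw qw'; rewrite !dotE; clra.
  have [dy0|dy0] := leP dy 0; first by apply: (le_trans dy0).
  rewrite (gtr0_norm dy0) in key2; rewrite -(ler_pM2l k0).
  have := mulr_gt0 k0 dy0; have := mulr_ge0 (ltW k0) (normr_ge0 dh).
  move: (ler_wpM2l (ltW dy0) qqw) key2 key3; clra.
move=> h y h' y' hh yy hh' yy' p p' sp pw sp' pw'; rewrite ler_norml; apply/andP; split.
  have := mono h' y' h y hh' yy' hh yy p' p sp' pw' sp pw.
  by rewrite (distrC h' h); lra.
exact: mono sp pw sp' pw'.
Qed.

(** * The singular graph *)

(** Let [p0] be the minimizer of [H] at [x0]. The curve [c] runs through the points of a thin
cone at [x0] around [v] whose superdifferential contains an element with the component of [p0]
along [rot v]; they form a Lipschitz graph over the axis, and [c] is parametrized by the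
component along [v], in units of [v]. Then [a s] is the speed with which a curve of velocity
[v#] passes [c s] in this parameter. Applied at [c s] with the same transversal direction
[rot v], [crossing_exists] yields further points of the cone at [x0], which lie on the graph by
uniqueness; this gives the right tangent. *)
Lemma singular_graph x0 (v := vsharp H u x0) : Sigma Omega u x0 -> v != 0 ->
  exists (S L : R) (c : R -> 'rV[R]_2) (a : R -> R), [/\ 0 < S, c 0 = x0,
    forall s, 0 <= s <= S -> Sigma Omega u (c s) /\ 2^-1 <= a s <= 2,
    forall s s', 0 <= s <= S -> 0 <= s' <= S -> `|c s - c s'| <= L * `|s - s'| &
    forall s, 0 <= s < S -> forall e, 0 < e -> exists2 dl : R, 0 < dl &
      forall k, 0 < k < dl ->
      [/\ `|c (s + k) - c s - (k / a s) *: vsharp H u (c s)| <= e * k,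
          `|vsharp H u (c (s + k)) - vsharp H u (c s)| <= e &
          `|a (s + k) - a s| <= e]].
Proof.
move=> xS v0; set w := rot v; set p0 := psharp H u x0.
have xO : Omega x0 := xS.1.
have sp0 : D x0 p0 := (psharpP x0 xO).1.
set N := dot v v; have N0 : 0 < N by exact: dot_gt0.
have ww : dot w w = N by rewrite /N /w !dot2E !rotE; ring.
have vw0 : dot v w = 0 by rewrite dotC dot_rot.
have vw : dot (rot v) w != 0 by rewrite ww gt_eqF.
have [k [dl [k0 dl0 sing lip]]] := crossing_lipschitz x0 w xS vw.
rewrite -/v -/p0 in sing lip.
pose V := `|v| + `|w| + 1; have V0 : 0 < V by rewrite /V ltr_wpDl// addr_ge0.
have vV : `|v| <= V by rewrite /V; have := normr_ge0 w; lra.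
have wV : `|w| <= V by rewrite /V; have := normr_ge0 v; lra.
pose rho := Num.min (k / (4 * V)) (Num.min (N / (4 * V)) (dl * N / (8 * V))).
have rho0 : 0 < rho by rewrite !lt_min !divr_gt0// mulr_gt0.
have rk : 2 * (rho * V) < k.
  have : rho <= k / (4 * V) by rewrite /rho ge_min lexx.
  by rewrite ler_pdivlMr ?mulr_gt0//; lra.
have ra : 2 * (rho * V) <= N / 2.
  have : rho <= N / (4 * V) by rewrite /rho !ge_min lexx !orbT.
  by rewrite ler_pdivlMr ?mulr_gt0//; lra.
have rb : 2 * (rho * V) <= dl / 4 * N.
  have : rho <= dl * N / (8 * V) by rewrite /rho !ge_min lexx !orbT.
  by rewrite ler_pdivlMr ?mulr_gt0//; lra.
have [d2 d20 near] := sharp_near x0 w _ xS vw rho0.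
rewrite -/v -/p0 in near.
pose eps := Num.min (Num.min dl d2) 1.
have eps0 : 0 < eps by rewrite !lt_min dl0 d20 ltr01.
have epsdl : eps <= dl by rewrite /eps !ge_min lexx.
have epsd2 : eps <= d2 by rewrite /eps !ge_min lexx orbT.
have eps1 : eps <= 1 by rewrite /eps !ge_min lexx !orbT.
have [d1 d10 cross] := crossing_exists x0 w eps xS vw eps0.
rewrite -/v -/p0 in cross.
pose m := Num.min dl (Num.min d1 d2).
have m0 : 0 < m by rewrite !lt_min dl0 d10.
pose S := m / 2; have S0 : 0 < S by rewrite /S; lra.
have Sm s : s <= S -> [/\ s < dl, s < d1 & s < d2].
  move=> sS; have : s < m by apply: (le_lt_trans sS); rewrite ltr_pdivrMr// ltr_pMr// ltr1n.
  by rewrite !lt_min => /andP[s1 /andP[s2 s3]]; split.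
have vE0 : vsharp H u x0 = v by [].
have pE0 : psharp H u x0 = p0 by [].
have NE : dot v v = N by [].
have dec q : q = (dot q v / N) *: v + (dot q w / N) *: w by exact: rot_decomp.
have rotN a b : dot (rot (a *: v + b *: w)) w = a * N.
  by rewrite -NE /w !dot2E !mxE/=; ring.
clearbody w v p0 N rho eps S.
(* The parameter of the graph: g s is the transversal coordinate over s, so that at s = 0
   the only candidate is 0. *)
pose G (s : R) := [set Y : R | exists y : R, [/\ `|y| <= eps, Y = s * y &
  exists2 p, D (pt x0 v w s y) p & dot (p - p0) w = 0]].
pose g (s : R) := xget 0 (G s).
have gP s : 0 <= s <= S -> exists y : R, [/\ `|y| <= eps, g s = s * y &
    exists2 p, D (pt x0 v w s y) p & dot (p - p0) w = 0].
  move=> /andP[s0 sS]; suff [Y hY] : exists Y, G s Y.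
    exact: (@xgetPex _ 0 (G s) (ex_intro _ Y hY)).
  move: s0; rewrite le_eqVlt => /predU1P[<-|s0].
    exists 0, 0; split; [by rewrite normr0 ltW|by rewrite mulr0|exists p0].
      by rewrite scale0r addr0.
    by rewrite subrr dot0l.
  have [_ sd _] := Sm s sS.
  have hs : 0 < s < d1 by rewrite s0.
  by have [y ye [p sp pw]] := cross s hs; exists (s * y), y; split => //; exists p.
pose c (s : R) := x0 + (s *: v + g s *: w).
have cD s : c s = x0 + (s *: v + g s *: w) by [].
clearbody g c.
have cE (s y : R) : g s = s * y -> c s = pt x0 v w s y.
  by move=> gs; rewrite cD gs scalerDr scalerA.
pose a s := dot (vsharp H u (c s)) v / N.
pose b s := dot (vsharp H u (c s)) w / N.
have vE s : vsharp H u (c s) = a s *: v + b s *: w by exact: dec.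
have aE s : a s = dot (vsharp H u (c s)) v / N by [].
have g0 : g 0 = 0.
  by have [|y [_ -> _]] := gP 0; [rewrite lexx ltW | rewrite mul0r].
have c0 : c 0 = x0 by rewrite cD g0 !scale0r !addr0.
have base s : 0 <= s <= S -> [/\ Sigma Omega u (c s),
    `|psharp H u (c s) - p0| < rho & `|vsharp H u (c s) - v| < rho].
  move=> hs; case/andP: (hs); rewrite le_eqVlt => /predU1P[<- _|s0 sS].
    by rewrite c0 vE0 pE0 !subrr normr0.
  have [sdl sd1 sd2] := Sm s sS.
  have [y [ye gs [p sp pw]]] := gP s hs; rewrite (cE _ _ gs).
  have hdl : 0 < s < dl by rewrite s0.
  have hd2 : 0 < s < d2 by rewrite s0.
  have pk : `|dot (p - p0) w| < k by rewrite pw normr0.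
  have [h1 h2] := near s y hd2 (le_trans ye epsd2) p sp pw.
  by split; [exact: sing hdl (le_trans ye epsdl) p sp pk|exact: h1|exact: h2].
have aP s : 0 <= s <= S -> 2^-1 <= a s <= 2.
  move=> /base[_ _]; rewrite /a; move: (vsharp H u (c s)) => q hq.
  have : `|dot (q - v) v| <= N / 2.
    apply: (le_trans (ler_dot _ _)); apply: le_trans ra.
    by rewrite ler_wpM2l// ler_pM// ltW.
  rewrite dotDl dotNl NE ler_norml => /andP[h1 h2].
  by rewrite ler_pdivlMr// ler_pdivrMr//; move: h1 h2; clra.
have bP s : 0 <= s <= S -> `|b s| <= dl / 4.
  move=> /base[_ _]; rewrite /b; move: (vsharp H u (c s)) => q hq.
  rewrite normrM normfV (gtr0_norm N0) ler_pdivrMr//.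
  have -> : dot q w = dot (q - v) w by rewrite dotDl dotNl vw0 subr0.
  apply: (le_trans (ler_dot _ _)); apply: le_trans rb.
  by rewrite ler_wpM2l// ler_pM// ltW.
clearbody a b.
have glip s s' : 0 <= s <= S -> 0 <= s' <= S -> `|g s - g s'| <= `|s - s'|.
  have g1 t : 0 <= t <= S -> `|g t| <= `|t|.
    move=> /gP[y [ye -> _]]; rewrite normrM -[leRHS]mulr1 ler_wpM2l//.
    exact: le_trans eps1.
  move=> hs hs'; case/andP: (hs); rewrite le_eqVlt => /predU1P[<- _|s0 sS].
    by rewrite g0 !sub0r !normrN g1.
  case/andP: (hs'); rewrite le_eqVlt => /predU1P[<- _|s'0 s'S].
    by rewrite g0 !subr0 g1.
  have [y [ye gs [p sp pw]]] := gP s hs; have [y' [ye' gs' [p' sp' pw']]] := gP s' hs'.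
  rewrite gs gs'; have [sdl _ _] := Sm s sS; have [s'dl _ _] := Sm s' s'S.
  have hdl : 0 < s < dl by rewrite s0.
  have hdl' : 0 < s' < dl by rewrite s'0.
  have pk : `|dot (p - p0) w| < k by rewrite pw normr0.
  have pk' : `|dot (p' - p0) w| < k by rewrite pw' normr0.
  exact: (lip s y s' y' hdl (le_trans ye epsdl) hdl' (le_trans ye' epsdl) p p' sp pk sp' pk').
have guniq (s Y : R) p : 0 < s <= S -> `|Y| <= s * dl ->
    D (x0 + (s *: v + Y *: w)) p -> `|dot (p - p0) w| < k -> g s = Y.
  move=> /andP[s0 sS] Ys sp pw; have hs : 0 <= s <= S by rewrite ltW.
  have [sdl _ _] := Sm s sS.
  have [y [ye gs [p' sp' pw']]] := gP s hs.
  have YE : Y = s * (Y / s) by field; rewrite gt_eqF.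
  have Yd : `|Y / s| <= dl.
    by rewrite normrM normfV (gtr0_norm s0) ler_pdivrMr// mulrC.
  have ptY : x0 + (s *: v + Y *: w) = pt x0 v w s (Y / s).
    by rewrite scalerDr scalerA -YE.
  rewrite ptY in sp.
  have hdl : 0 < s < dl by rewrite s0.
  have pk : `|dot (p' - p0) w| < k by rewrite pw' normr0.
  have := lip s y s (Y / s) hdl (le_trans ye epsdl) hdl Yd p' p sp' pk sp pw.
  by rewrite -gs -YE subrr normr0 normr_le0 subr_eq0 => /eqP.
exists S, V, c, a; split; [exact: S0|exact: c0| | |].
- by move=> s hs; split; [have [] := base s hs | exact: aP].
- move=> s s' hs hs'.
  have -> : c s - c s' = (s - s') *: v + (g s - g s') *: w.
    rewrite !cD opprD addrACA subrr add0r opprD addrACA.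
    by rewrite !scalerBl.
  apply: (le_trans (ler_normD _ _)); rewrite !normrZ.
  have := ler_wpM2r (normr_ge0 w) (glip s s' hs hs').
  have := mulr_ge0 (normr_ge0 (s - s')) (ler01).
  have -> : V * `|s - s'| = `|s - s'| * `|v| + `|s - s'| * `|w| + `|s - s'| * 1.
    by rewrite /V; ring.
  by clra.
move=> s /andP[s0 sS] e e0; have hs : 0 <= s <= S by rewrite s0 ltW.
have [S1 psh vsh] := base s hs; have /andP[a1 a2] := aP s hs.
have a0 : 0 < a s by move: a1; clra.
set x1 := c s in S1 psh vsh *; set v1 := vsharp H u x1 in vsh *.
have v1w : dot (rot v1) w != 0.
  have -> : dot (rot v1) w = a s * N; last by rewrite mulf_neq0// gt_eqF.
  by rewrite /v1 /x1 vE rotN.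
pose e' := Num.min e (e * N / (2 * V)).
have e'0 : 0 < e' by rewrite lt_min e0 divr_gt0// mulr_gt0.
have e'e : e' <= e by rewrite /e' ge_min lexx.
have e'N : 2 * (e' * V) <= e * N.
  have : e' <= e * N / (2 * V) by rewrite /e' ge_min lexx orbT.
  by rewrite ler_pdivlMr ?mulr_gt0//; clra.
have [d3 d30 near1] := sharp_near x1 w _ S1 v1w e'0.
rewrite -/v1 in near1.
pose eta := Num.min (Num.min d3 (dl / 4)) (e / (2 * V)).
have eta0 : 0 < eta by rewrite !lt_min d30 !divr_gt0// mulr_gt0.
have etad3 : eta <= d3 by rewrite /eta !ge_min lexx.
have etadl : eta <= dl / 4 by rewrite /eta !ge_min lexx orbT.
have etae : eta * (2 * V) <= e.
  have : eta <= e / (2 * V) by rewrite /eta !ge_min lexx !orbT.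
  by rewrite ler_pdivlMr ?mulr_gt0.
have [d4 d40 cross1] := crossing_exists x1 w eta S1 v1w eta0.
rewrite -/v1 in cross1.
pose d5 := Num.min (S - s) (Num.min (d3 / 2) (d4 / 2)).
exists d5; first by rewrite !lt_min subr_gt0 sS !divr_gt0.
move=> j; rewrite !lt_min => /and4P[j0 jS j3 j4].
pose h := j / a s; have h0 : 0 < h by rewrite divr_gt0.
have hj : h * a s = j by rewrite divfK ?gt_eqF.
have h2j : h <= 2 * j.
  by rewrite ler_pdivrMr//; move: (ler_wpM2l (ltW j0) a1); clra.
have h4 : 0 < h < d4 by rewrite h0/=; move: h2j j4; clra.
have h3 : 0 < h < d3 by rewrite h0/=; move: h2j j3; clra.
have [y ye [p sp pw]] := cross1 h h4.
have [nearp nearv] := near1 h y h3 (le_trans ye etad3) p sp pw.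
pose Y := g s + h * (b s + y).
have zE : pt x1 v1 w h y = x0 + ((s + j) *: v + Y *: w).
  rewrite /Y -hj; move: (vE s) (cD s); rewrite -/v1 -/x1 => -> ->.
  by apply: row2_eq; rewrite !mxE; ring.
have gj : g (s + j) = Y.
  apply: (guniq _ _ p).
  - by move: s0 j0 jS; clra.
  - have [y0 [ye0 gs _]] := gP s hs.
    have h1 : `|g s| <= s * dl.
      by rewrite gs normrM (ger0_norm s0) ler_wpM2l//; exact: le_trans epsdl.
    have h2 : `|h * (b s + y)| <= j * dl.
      rewrite -hj normrM (gtr0_norm h0) -mulrA ler_wpM2l ?(ltW h0)//.
      apply: (le_trans (ler_normD _ _)); have aS : dl / 2 <= a s * dl.
        by move: (ler_wpM2r (ltW dl0) a1); clra.
      by move: (bP s hs) ye etadl aS; clra.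
    by rewrite mulrDl; apply: (le_trans (ler_normD _ _)); exact: lerD.
  - by rewrite -zE.
  - have -> : dot (p - p0) w = dot (p - psharp H u x1) w + dot (psharp H u x1 - p0) w.
      by rewrite !dotE; ring.
    rewrite pw add0r; apply: le_lt_trans rk; apply: (le_trans (ler_dot _ _)).
    by rewrite ler_wpM2l// ler_pM// ltW.
have cz : c (s + j) = pt x1 v1 w h y by rewrite cD gj -zE.
rewrite cz; split; last 2 first.
- by apply: (le_trans (ltW nearv)).
- rewrite !aE cz -/x1 -/v1 -mulrBl normrM normfV (gtr0_norm N0) ler_pdivrMr// -dotNl -dotDl.
  apply: (le_trans (ler_dot _ _)); apply: le_trans e'N.
  by rewrite ler_wpM2l// ler_pM// ltW.
have -> : pt x1 v1 w h y - x1 - h *: v1 = (h * y) *: w.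
  by apply: row2_eq; rewrite !mxE; ring.
rewrite normrZ normrM (gtr0_norm h0).
have q1 : `|y| * `|w| <= eta * V by rewrite ler_pM.
have q2 : 0 <= eta * V by rewrite mulr_ge0// ltW.
by move: (ler_wpM2l (ltW h0) q1) (ler_wpM2r q2 h2j) (ler_wpM2l (ltW j0) etae); clra.
Qed.

End HamiltonJacobi.

(** * Change of parameter *)

Section TimeChange.
Context {R : realType}.
Implicit Types (f phi : R -> R) (s t a b m e k : R).

(** A bounded function has an additive indefinite integral: the upper Darboux integral,
obtained as the supremum of the functions whose increment over every interval is at most its
length times the supremum of [f] there. *)
Lemma interval_integral f (S : R) : (forall s, 0 <= s <= S -> 2^-1 <= f s <= 2) ->
  exists tau : R -> R, tau 0 = 0 /\ forall a b m, 0 <= a -> a <= b -> b <= S ->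
    ((forall s, a <= s <= b -> f s <= m) -> tau b - tau a <= (b - a) * m) /\
    ((forall s, a <= s <= b -> m <= f s) -> (b - a) * m <= tau b - tau a).
Proof.
move=> fb.
pose Phi b := [set phi | phi 0 = 0 /\ forall a' b' m, 0 <= a' -> a' <= b' -> b' <= b ->
  (forall s, a' <= s <= b' -> f s <= m) -> phi b' - phi a' <= (b' - a') * m].
pose X b := [set phi b | phi in Phi b].
have supX b : 0 <= b <= S -> has_sup (X b).
  move=> /andP[b0 bS]; split.
    exists (b * 2^-1), (fun s => s * 2^-1) => //; split; first by rewrite mul0r.
    move=> a' b' m a0 ab bb' /(_ a'); rewrite lexx ab => /(_ isT) fm.
    have /fb/andP[f1 _] : 0 <= a' <= S by rewrite a0 (le_trans ab) ?(le_trans bb').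
    by rewrite -mulrBl ler_wpM2l ?subr_ge0// (le_trans f1).
  exists (b * 2) => _ [phi [p0 hphi] <-].
  have := hphi 0 b 2 (lexx 0) b0 (lexx b); rewrite p0 !subr0; apply.
  by move=> s /andP[s0 sb]; have /fb/andP[] : 0 <= s <= S by rewrite s0 (le_trans sb).
pose tau b := sup (X b); exists (fun s => tau s - tau 0); split; first by rewrite subrr.
move=> a b m a0 ab bS.
have hb : 0 <= b <= S by rewrite (le_trans a0 ab).
have ha : 0 <= a <= S by rewrite a0 (le_trans ab).
have -> : tau b - tau 0 - (tau a - tau 0) = tau b - tau a by ring.
split=> hm.
  rewrite lerBlDl; apply: sup_le_ub; first by have [] := supX b hb.
  move=> _ [phi [p0 hphi] <-].
  have : phi a <= tau a.
    apply: sup_upper_bound; first exact: supX.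
    exists phi => //; split => // a' b' m' a'0 ab' b'a; apply: hphi => //.
    exact: le_trans ab.
  by have := hphi a b m a0 ab (lexx b) hm; lra.
rewrite lerBrDl -lerBrDr; apply: sup_le_ub; first by have [] := supX a ha.
move=> _ [phi [p0 hphi] <-]; rewrite lerBrDr.
pose psi t := if t <= a then phi t else phi a + (t - a) * m.
have psib : psi b = phi a + (b - a) * m.
  rewrite /psi; case: ifP => // ba; have -> : b = a by apply/le_anti; rewrite ab ba.
  by rewrite subrr mul0r addr0.
rewrite -psib; apply: sup_upper_bound; first exact: supX.
exists psi => //; split; first by rewrite /psi a0.
move=> a' b' m' a'0 ab' b'b fm'; rewrite /psi.
case: (leP b' a) => b'a.
  by rewrite (le_trans ab' b'a); apply: hphi.
have mm' s : a <= s -> a' <= s <= b' -> m <= m'.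
  move=> sa /andP[s1 s2]; apply: (@le_trans _ _ (f s)); last by apply: fm'; rewrite s1.
  by apply: hm; rewrite sa (le_trans s2).
case: (leP a' a) => a'a.
  have h1 : phi a - phi a' <= (a - a') * m'.
    apply: hphi => // s /andP[s1 s2]; apply: fm'; rewrite s1 (le_trans s2)// ltW//.
  have h2 : (b' - a) * m <= (b' - a) * m'.
    by rewrite ler_wpM2l ?subr_ge0 ?(ltW b'a)// (mm' a)// a'a ltW.
  by lra.
have h2 : (b' - a') * m <= (b' - a') * m'.
  by rewrite ler_wpM2l ?subr_ge0// (mm' a' (ltW a'a))// lexx.
lra.
Qed.

(** Solve [sigma' = a sigma] from the right for a right-continuous [a]: invert the time needed to
reach a parameter, which is the integral of [1 / a]. *)
Lemma time_change (S : R) (a : R -> R) : 0 < S ->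
  (forall s, 0 <= s <= S -> 2^-1 <= a s <= 2) ->
  (forall s, 0 <= s < S -> forall e, 0 < e -> exists2 dl : R, 0 < dl &
    forall k, 0 < k < dl -> `|a (s + k) - a s| <= e) ->
  exists (t0 : R) (sigma : R -> R), [/\ 0 < t0, sigma 0 = 0,
    forall t, 0 <= t <= t0 -> 0 <= sigma t <= S,
    forall t t', 0 <= t -> t < t' -> t' <= t0 -> 0 < sigma t' - sigma t <= 2 * (t' - t) &
    forall t, 0 <= t < t0 -> forall e, 0 < e -> exists2 dl : R, 0 < dl &
      forall k, 0 < k < dl -> `|sigma (t + k) - sigma t - k * a (sigma t)| <= e * k].
Proof.
move=> S0 ab rc; pose f s := (a s)^-1.
have fb s : 0 <= s <= S -> 2^-1 <= f s <= 2.
  move=> /ab /andP[a1 a2]; have a0 : 0 < a s by lra.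
  by rewrite /f lef_pV2 ?posrE// a2/= -[leRHS]invrK lef_pV2// posrE.
have [tau [tau0 htau]] := interval_integral f S fb.
have tau_lb x y : 0 <= x -> x <= y -> y <= S -> (y - x) * 2^-1 <= tau y - tau x.
  move=> x0 xy yS; apply: (htau x y 2^-1 x0 xy yS).2 => s /andP[s1 s2].
  by have /fb/andP[] : 0 <= s <= S by rewrite (le_trans x0 s1) (le_trans s2).
have tau_ub x y : 0 <= x -> x <= y -> y <= S -> tau y - tau x <= (y - x) * 2.
  move=> x0 xy yS; apply: (htau x y 2 x0 xy yS).1 => s /andP[s1 s2].
  by have /fb/andP[] : 0 <= s <= S by rewrite (le_trans x0 s1) (le_trans s2).
have tau_lip x y : 0 <= x <= S -> 0 <= y <= S -> `|tau x - tau y| <= `|x - y| * 2.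
  move=> /andP[x0 xS] /andP[y0 yS]; case: (leP x y) => xy.
    have := tau_lb x y x0 xy yS; have := tau_ub x y x0 xy yS => h1 h2.
    by rewrite distrC (distrC x) !ger0_norm//; lra.
  have := tau_lb y x y0 (ltW xy) xS; have := tau_ub y x y0 (ltW xy) xS => h1 h2.
  by rewrite !ger0_norm//; lra.
pose t0 := tau S.
have t00 : 0 < t0.
  by have := tau_lb 0 S (lexx 0) (ltW S0) (lexx S); rewrite tau0 /t0; lra.
have tau_cont : {within `[0, S], continuous tau}%classic.
  apply/continuous_within_itvP => //; split.
  - move=> x; rewrite in_itv/= => /andP[x0 xS]; apply/continuous_atP => e e0.
    exists (Num.min (e / 2) (Num.min x (S - x))).
      by rewrite !lt_min x0 subr_gt0 xS divr_gt0.
    move=> y; rewrite !lt_min => /and3P[ye yx yS]; move: yx yS; rewrite !ltr_norml => yx yS.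
    have hx : 0 <= x <= S by lra.
    have hy : 0 <= y <= S by lra.
    by have := tau_lip y x hy hx; rewrite ler_norml; lra.
  - apply/cvgrPdist_le => e e0; near=> y.
    have y0 : 0 < y by near: y; exact: nbhs_right_gt.
    have ye : y < e / 2 by near: y; apply: nbhs_right_lt; lra.
    have yS : y < S by near: y; exact: nbhs_right_lt.
    have hy : 0 <= y <= S by lra.
    have h0 : 0 <= (0 : R) <= S by lra.
    by have := tau_lip 0 y h0 hy; rewrite sub0r normrN (gtr0_norm y0); lra.
  - apply/cvgrPdist_le => e e0; near=> y.
    have y0 : 0 < y by near: y; exact: nbhs_left_gt.
    have yS : y < S by near: y; exact: nbhs_left_lt.
    have ye : S - e / 2 < y by near: y; apply: nbhs_left_gt; lra.
    have hy : 0 <= y <= S by lra.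
    have hS : 0 <= S <= S by lra.
    have := tau_lip S y hS hy; rewrite (@ger0_norm _ (S - y)); lra.
pose Y t := [set s | 0 <= s <= S /\ tau s = t].
pose sigma t := xget 0 (Y t).
have sP t : 0 <= t <= t0 -> 0 <= sigma t <= S /\ tau (sigma t) = t.
  move=> ht; have [c cS ct] : exists2 c, c \in `[0, S] & tau c = t.
    by apply: IVT => //; [exact: ltW|rewrite tau0 (min_l (ltW t00)) (max_r (ltW t00))].
  have hc : Y t c by split => //; move: cS; rewrite in_itv.
  exact: (@xgetPex _ 0 (Y t) (ex_intro _ c hc)).
have smon t t' : 0 <= t -> t < t' -> t' <= t0 -> 0 < sigma t' - sigma t <= 2 * (t' - t).
  move=> ht tt' ht'.
  have [/andP[s0 sS] st] : 0 <= sigma t <= S /\ tau (sigma t) = t by apply: sP; lra.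
  have [/andP[s'0 s'S] st'] : 0 <= sigma t' <= S /\ tau (sigma t') = t' by apply: sP; lra.
  case: (leP (sigma t') (sigma t)) => h.
    by have := tau_lb _ _ s'0 h sS; rewrite st st'; lra.
  by have := tau_lb _ _ s0 (ltW h) s'S; rewrite st st'; lra.
exists t0, sigma; split => //.
- have [|/andP[s0 sS] st] := sP 0; first by rewrite lexx ltW.
  by have := tau_lb 0 _ (lexx 0) s0 sS; rewrite st tau0; lra.
- by move=> t /sP[].
move=> t /andP[th0 tt0] e e0.
have [hs st] : 0 <= sigma t <= S /\ tau (sigma t) = t by apply: sP; lra.
set s := sigma t in hs st *; have /andP[s0 sS] := hs.
have sltS : s < S.
  rewrite lt_neqAle sS andbT; apply/eqP => sE; move: tt0.
  by rewrite /t0 -sE st ltxx.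
have hs' : 0 <= s < S by rewrite s0.
have e16 : 0 < e / 16 by rewrite divr_gt0.
have [dl dl0 hdl] := rc s hs' _ e16.
exists (Num.min (dl / 2) (t0 - t)); first by rewrite lt_min subr_gt0 tt0 divr_gt0.
move=> k; rewrite lt_min => /and3P[k0 kd kt].
have tk : t < t + k by lra.
have tkt0 : t + k <= t0 by lra.
have := smon t (t + k) th0 tk tkt0; rewrite -/s (addrAC t) subrr add0r => /andP[d0 d1].
have [/andP[s'0 s'S] st'] : 0 <= sigma (t + k) <= S /\ tau (sigma (t + k)) = t + k.
  by apply: sP; lra.
set s' := sigma (t + k) in d0 d1 s'0 s'S st' *.
have /andP[as1 as2] := ab s hs; have as0 : 0 < a s by lra.
have fe x : s <= x <= s' -> `|f x - f s| <= e / 4.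
  move=> /andP[sx xs']; have [<-|nsx] := eqVneq s x; first by rewrite subrr normr0 divr_ge0// ltW.
  have hx : 0 <= x <= S by rewrite (le_trans s0 sx) (le_trans xs').
  have /andP[ax1 ax2] := ab x hx; have ax0 : 0 < a x by move: ax1; clear; lra.
  have sx' : s < x by rewrite lt_neqAle nsx.
  have hk : 0 < x - s < dl by move: sx' xs' d1 kd; clear; lra.
  have := hdl _ hk; rewrite (addrC s) subrK => hax.
  have -> : f x - f s = (a s - a x) * (f x * f s).
    by rewrite /f; field; rewrite !gt_eqF.
  have /andP[fx1 fx2] := fb x hx; have /andP[fs1 fs2] := fb s hs.
  have ff : 0 <= f x * f s <= 4.
    have fx0 : 0 <= f x by move: fx1; clear; lra.
    have fs0 : 0 <= f s by move: fs1; clear; lra.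
    rewrite mulr_ge0//; move: (ler_pM fx0 fs0 fx2 fs2); clear; lra.
  rewrite normrM distrC (@ger0_norm _ (f x * f s)); last by case/andP: ff.
  have := normr_ge0 (a x - a s); case/andP: ff => ff0 ff4 n0.
  by move: (ler_pM n0 ff0 hax ff4); clear; lra.
have ss' : s <= s' by lra.
have up : tau s' - tau s <= (s' - s) * (f s + e / 4).
  apply: (htau s s' _ s0 ss' s'S).1 => x /fe; rewrite ler_norml; lra.
have lo : (s' - s) * (f s - e / 4) <= tau s' - tau s.
  apply: (htau s s' _ s0 ss' s'S).2 => x /fe; rewrite ler_norml; lra.
rewrite st st' in up lo.
have fa : f s * a s = 1 by rewrite /f mulVf// gt_eqF.
have up' := ler_wpM2r (ltW as0) up; have lo' := ler_wpM2r (ltW as0) lo.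
have E1 : (s' - s) * (f s + e / 4) * a s = (s' - s) + (s' - s) * a s * (e / 4).
  by rewrite mulrDr mulrDl -mulrA fa; ring.
have E2 : (s' - s) * (f s - e / 4) * a s = (s' - s) - (s' - s) * a s * (e / 4).
  by rewrite mulrBr mulrBl -mulrA fa; ring.
rewrite E1 in up'; rewrite E2 in lo'.
have B : (s' - s) * a s * (e / 4) <= e * k.
  have -> : e * k = 2 * k * 2 * (e / 4) by field.
  apply: ler_wpM2r; first by rewrite divr_ge0// ltW.
  exact: ler_pM (ltW d0) (ltW as0) d1 as2.
rewrite (addrAC t) subrr add0r in up' lo'.
by rewrite ler_norml; move: up' lo' B; clear; lra.
Unshelve. all: by end_near.
Qed.

End TimeChange.

(** * The singular characteristic *)

Lemma cvg_at_rightP {R : realType} {V : normedModType R} (f : R -> V) (t : R) (l : V) :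
  (forall e : R, 0 < e -> exists2 dl : R, 0 < dl &
    forall k, 0 < k < dl -> `|f (t + k) - l| <= e) ->
  f s @[s --> t^'+] --> l.
Proof.
move=> h; apply/cvgrPdist_le => e e0; have [dl dl0 hdl] := h e e0.
near=> s; rewrite distrC (_ : s = t + (s - t)); last by rewrite addrC subrK.
apply: hdl; apply/andP; split; first by rewrite subr_gt0; near: s; exact: nbhs_right_gt.
by rewrite ltrBlDl; near: s; apply: nbhs_right_lt; rewrite ltrDl.
Unshelve. all: by end_near.
Qed.

Theorem theorem1p1 (R : realType)
    (H : 'rV[R]_2 -> 'rV[R]_2 -> R -> R)
    (HC1 : C1 (fun z : ('rV[R]_2 * 'rV[R]_2 * R)%type => H z.1.1 z.1.2 z.2))
    (Hconvex : forall (x : 'rV[R]_2) (r : R),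
       strictly_convex (fun p => H x p r))
    (Omega : set 'rV[R]_2) (Oopen : open Omega) (Oconn : connected Omega)
    (u : 'rV[R]_2 -> R) (usol : viscosity_solution H Omega u)
    (x0 : 'rV[R]_2) (x0sing : Sigma Omega u x0) :
  exists (t0 : R) (gamma : R -> 'rV[R]_2),
    [/\ 0 < t0,
        [lipschitz gamma t | t in `[0, t0]%classic],
        gamma 0 = x0 &
        [/\ forall t : R, 0 <= t < t0 ->
              (s - t)^-1 *: (gamma s - gamma t) @[s --> t^'+]
                --> vsharp H u (gamma t),
            forall t : R, 0 <= t < t0 ->
              vsharp H u (gamma s) @[s --> t^'+] --> vsharp H u (gamma t) &
            forall t : R, 0 <= t <= t0 -> Sigma Omega u (gamma t)]].
Proof.
have [v0|v0] := eqVneq (vsharp H u x0) 0.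
  exists 1, (fun=> x0); split => //.
    exists 0; split; [exact: num_real|move=> M M0 /= [s t] _ /=].
    by rewrite subrr normr0 mulr_ge0// ltW.
  split => // t _; last exact: cvg_cst.
  under eq_fun do rewrite subrr scaler0.
  by rewrite v0; exact: cvg_cst.
have [S [L [c [a [S0 c0 sing clip tangent]]]]] :=
  singular_graph H HC1 Hconvex Omega u usol x0 x0sing v0.
have [||t0 [sigma [t00 sg0 sgS sgmon sgder]]] := time_change S a S0.
- by move=> s /sing[].
- move=> s hs e e0; have [dl dl0 hdl] := tangent s hs e e0.
  by exists dl => // k /hdl[].
have L0 : 0 <= L.
  have := clip S 0; rewrite !lexx (ltW S0) subr0 => /(_ isT isT).
  by move/(le_trans (normr_ge0 _)); rewrite pmulr_lge0// normr_gt0 gt_eqF.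
have sgle t t' : 0 <= t <= t0 -> 0 <= t' <= t0 -> `|sigma t - sigma t'| <= 2 * `|t - t'|.
  wlog tt' : t t' / t <= t'.
    move=> gen ht ht'; case: (leP t t') => [|/ltW] h; first exact: gen.
    by rewrite distrC (distrC t); exact: gen.
  move=> /andP[th0 _] /andP[_ t't0]; move: tt'; rewrite le_eqVlt => /predU1P[->|tt'].
    by rewrite !subrr normr0 mulr0.
  have /andP[h1 h2] := sgmon t t' th0 tt' t't0.
  by rewrite distrC (distrC t) (gtr0_norm h1) gtr0_norm// subr_gt0.
have sglt t : 0 <= t < t0 -> 0 <= sigma t < S.
  move=> /andP[th0 tt0]; have h : 0 <= t0 <= t0 by rewrite lexx ltW.
  have /andP[_ sS] := sgS t0 h; have /andP[h1 _] := sgmon t t0 th0 tt0 (lexx _).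
  have h' : 0 <= t <= t0 by rewrite th0 ltW.
  by have /andP[-> _] := sgS t h'; lra.
exists t0, (c \o sigma); split; [exact: t00| | |split].
- exists (L * 2); split; [exact: num_real|move=> M LM /= [s t] /= []].
  rewrite !in_itv/= => hs ht.
  apply: (le_trans (clip _ _ (sgS _ hs) (sgS _ ht))).
  apply: (@le_trans _ _ (L * (2 * `|s - t|))); first by rewrite ler_wpM2l// sgle.
  by rewrite mulrA ler_wpM2r// ltW.
- by rewrite /= sg0.
- move=> t ht; have hs := sglt t ht.
  rewrite /=; set s := sigma t in hs *; set v1 := vsharp H u (c s).
  apply: cvg_at_rightP => e e0.
  have e40 : 0 < e / 4 by rewrite divr_gt0.
  have n0 := normr_ge0 v1; have V0 : 0 < `|v1| + 1 by lra.
  have e20 : 0 < e / (4 * (`|v1| + 1)) by rewrite divr_gt0// mulr_gt0.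
  have [d1 d10 h1] := tangent s hs _ e40.
  have [d2 d20 h2] := sgder t ht _ e20.
  have /andP[th0 tt0] := ht.
  have hs' : 0 <= s <= S by lra.
  have [_ /andP[a1 a2]] := sing s hs'; have a0 : 0 < a s by lra.
  exists (Num.min (d1 / 2) (Num.min d2 (t0 - t))).
    by rewrite !lt_min d20 subr_gt0 tt0 divr_gt0.
  move=> k; rewrite !lt_min => /and4P[k0 k1 k2 kt].
  have tk : t < t + k by rewrite ltrDl.
  have tkt0 : t + k <= t0 by lra.
  have /andP[j0 j2] := sgmon t (t + k) th0 tk tkt0.
  have hk2 : 0 < k < d2 by rewrite k0.
  have := h2 k hk2; rewrite -/s in j0 j2 *.
  set j := sigma (t + k) - s in j0 j2 * => hj.
  have sj : sigma (t + k) = s + j by rewrite /j (addrC s) subrK.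
  have hj1 : 0 < j < d1 by lra.
  have [hc _ _] := h1 j hj1; rewrite sj -/v1 in hc *.
  have -> : t + k - t = k by rewrite addrC addKr.
  set r := c (s + j) - c s - (j / a s) *: v1 in hc.
  (* The increment of the curve is [(j / a s) *: v1 + r] with [r] small relative to [j], and [j]
     is close to [k * a s]. *)
  have -> : k^-1 *: (c (s + j) - c s) - v1 = k^-1 *: r + ((j - k * a s) / (k * a s)) *: v1.
    have -> : c (s + j) - c s = r + (j / a s) *: v1 by rewrite /r subrK.
    rewrite scalerDr -addrA; congr (_ + _); rewrite scalerA -[X in _ - X]scale1r -scalerBl.
    by congr (_ *: _); field; rewrite !gt_eqF.
  apply: (le_trans (ler_normD _ _)); rewrite !normrZ !normfV.
  rewrite (gtr0_norm k0) (gtr0_norm (mulr_gt0 k0 a0)).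
  have q1 : k^-1 * `|r| <= e / 2.
    rewrite ler_pdivrMl//; apply: (le_trans hc).
    have : e / 4 * j <= e / 4 * (2 * (t + k - t)) by rewrite ler_pM2l.
    have -> : t + k - t = k by rewrite addrC addKr.
    by lra.
  have q2 : `|j - k * a s| / (k * a s) * `|v1| <= e / 2.
    rewrite mulrAC ler_pdivrMr ?mulr_gt0//.
    apply: (@le_trans _ _ (e / (4 * (`|v1| + 1)) * k * (`|v1| + 1))).
      by apply: ler_pM => //; lra.
    have -> : e / (4 * (`|v1| + 1)) * k * (`|v1| + 1) = e / 4 * k.
      by field; rewrite gt_eqF.
    have : e / 4 * k * 2^-1 <= e / 4 * k * a s by rewrite ler_wpM2l// mulr_ge0// ltW.
    lra.
  lra.
- move=> t ht; have hs := sglt t ht; rewrite /=; set s := sigma t in hs *.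
  apply: cvg_at_rightP => e e0.
  have [d1 d10 h1] := tangent s hs e e0; have /andP[th0 tt0] := ht.
  exists (Num.min (d1 / 2) (t0 - t)); first by rewrite lt_min subr_gt0 tt0 divr_gt0.
  move=> k; rewrite lt_min => /and3P[k0 k1 kt].
  have tk : t < t + k by rewrite ltrDl.
  have tkt0 : t + k <= t0 by lra.
  have /andP[j0 j2] := sgmon t (t + k) th0 tk tkt0; rewrite -/s in j0 j2.
  have hj1 : 0 < sigma (t + k) - s < d1 by lra.
  by have [_ + _] := h1 _ hj1; rewrite (addrC s) subrK.
- by move=> t /sgS /sing[].
Qed.
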